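(* Let $r,s,t\ge2$ be integers with $s<t$. Let $Q_1,\dots,Q_t$ be $r$-graphs such that $m_r(Q_1)\ge\dots\ge m_r(Q_t)>0$ and $m_r(Q_{s+1})>1$. Let $\delta=\max\{\mu,\sigma\}$, where $$\mu=\max\{m(Q_1),\dots,m(Q_t)\}\quad\text{and}\quad\sigma=\min\{m_r(Q_i,Q_{s+1}):1\le i\le s\}.$$ If $p=p(n)\gg n^{-1/\delta}$, then $$\lim_{n\to\infty}\mathbb{P}\big(\mathcal{R}(H^{(r)}(n,p);s)\subseteq\mathcal{R}(Q_1,\dots,Q_t)\big)=1.$$
   Context: An $r$-graph $F$ is a finite $r$-uniform hypergraph with vertex set $V(F)$ and edge set $E(F)\subseteq\binom{V(F)}{r}$; $v(F)$ and $e(F)$ denote its numbers of vertices and edges. $J\subseteq F$ means that $J$ is a (not necessarily induced) subhypergraph of $F$. A copy of $F$ in $G$ is a subhypergraph of $G$ isomorphic to $F$. For $r$-graphs $G,F_1,\dots,F_s$, write $G\to(F_1,\dots,F_s)$ if every $s$-edge-coloring of $G$ yields a monochromatic copy of $F_i$ in the $i$-th color for some $1\le i\le s$. $\mathcal{R}(F_1,\dots,F_s)$ is the family of all $r$-graphs $G$ with $G\to(F_1,\dots,F_s)$, and $\mathcal{R}(F;s)=\mathcal{R}(F,\dots,F)$ with $F$ repeated $s$ times. Densities: $m(F)=\max_{J\subseteq F,\ v(J)\ge1}e(J)/v(J)$. The maximum $r$-density $m_r(F)$ is $0$ if $e(F)=0$, is $1/r$ if $e(F)=1$, and is $\max_{J\subseteq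 F,\ v(J)>r}\frac{e(J)-1}{v(J)-r}$ if $e(F)\ge2$. For $r$-graphs $T,F$ with $m_r(T)\ge m_r(F)>0$, the asymmetric maximum $r$-density is $$m_r(T,F)=\max_{J\subseteq T,\ v(J)\ge r}\frac{e(J)}{v(J)-r+m_r(F)^{-1}}.$$ $H^{(r)}(n,p)$ is the random $r$-graph on vertex set $[n]$ in which every $r$-subset of $[n]$ is an edge independently with probability $p$. $p\gg q$ means $p(n)/q(n)\to\infty$ as $n\to\infty$. *)

(* Defs.v *)
From HB Require Import structures.
From mathcomp Require Import all_boot all_order all_algebra.
From mathcomp Require Import all_classical all_reals all_analysis.

Set Implicit Arguments.
Unset Strict Implicit.
Unset Printing Implicit Defensive.

Import Order.TTheory GRing.Theory Num.Theory.
Import numFieldNormedType.Exports.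

Local Open Scope classical_set_scope.
Local Open Scope ring_scope.

Record hgraph (r : nat) := HGraph {
  vert : finType;
  edges : {set {set vert}};
  edges_uniform : forall e, e \in edges -> #|e| = r }.

(* A subhypergraph J of F is the pair (V(J), E(J)) of its vertex set and its
   edge set; it may have isolated vertices and need not be induced. *)
Definition subhgraphs r (F : hgraph r) :
    {set {set vert F} * {set {set vert F}}} :=
  [set J : {set vert F} * {set {set vert F}} |
    (J.2 \subset edges F) && [forall e in J.2, e \subset J.1]]%SET.

Definition copy r (F G : hgraph r) (J : {set vert G} * {set {set vert G}}) : Prop :=
  J \in subhgraphs G /\
  exists f : vert F -> vert G,
    [/\ injective f, f @: [set: vert F]%SET = J.1 &
        [set f @: (e : {set vert F}) | e in edges F]%SET = J.2].

Definition arrows r (G : hgraph r) k (F : 'I_k -> hgraph r) : Prop :=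
  forall c : {e : {set vert G} | e \in edges G} -> 'I_k,
  exists (i : 'I_k) (J : {set vert G} * {set {set vert G}}),
    copy (F i) J /\ forall e, val e \in J.2 -> c e = i.

(* A family of r-graphs is a bare predicate: [hgraph r] lives in a universe too
   large for [set]. *)
Definition hfamily (r : nat) := hgraph r -> Prop.

Definition subfamily r (A B : hfamily r) : Prop := forall G, A G -> B G.

Definition ramsey r k (F : 'I_k -> hgraph r) : hfamily r :=
  fun G => arrows G F.

Section Densities.
Variables (R : realType) (r : nat).
Implicit Types F T : hgraph r.

(* In the three maxima below the default value 0 is harmless: the maximum of
   the listed quotients is nonnegative (for [max_rdensity], J = F has v(J) > r
   as soon as e(F) >= 2). *)

Definition max_density F : R :=
  \big[Num.max/0]_(J in subhgraphs F | (1 <= #|J.1|)%N) (#|J.2|%:R / #|J.1|%:R).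

Definition max_rdensity F : R :=
  if #|edges F| == 0 then 0
  else if #|edges F| == 1 then r%:R^-1
  else \big[Num.max/0]_(J in subhgraphs F | (r < #|J.1|)%N)
         ((#|J.2|%:R - 1) / (#|J.1|%:R - r%:R)).

(* Meaningful when max_rdensity T >= max_rdensity F > 0. *)
Definition asym_rdensity T F : R :=
  \big[Num.max/0]_(J in subhgraphs T | (r <= #|J.1|)%N)
    (#|J.2|%:R / (#|J.1|%:R - r%:R + (max_rdensity F)^-1)).

End Densities.

Section RandomHypergraph.
Variables (R : realType) (r n : nat).

Definition rsubset := {e : {set 'I_n} | #|e| == r}.

Fact hgraph_of_uniform (A : {set rsubset}) (e : {set 'I_n}) :
  e \in [set val a | a in A]%SET -> #|e| = r.
Proof. by case/imsetP => a _ ->; apply/eqP/(valP a). Qed.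

Definition hgraph_of (A : {set rsubset}) : hgraph r :=
  HGraph (@hgraph_of_uniform A).

(* The probability that H^(r)(n, p) belongs to P: the outcome with edge set A
   has weight p^|A| (1 - p)^(C(n, r) - |A|). *)
Definition hprob (p : R) (P : hfamily r) : R :=
  \sum_(A : {set rsubset} | `[< P (hgraph_of A) >])
    p ^+ #|A| * (1 - p) ^+ #|~: A|%SET.

End RandomHypergraph.

(* p >> q; the quotient is 0 at the n where q vanishes. *)
Definition dominates (R : realType) (p q : nat -> R) : Prop :=
  p n / q n @[n --> \oo] --> +oo.

(* Main.v *)
(* Fix i <= s attaining sigma, and put T = Q_i. If H arrows (T, Q_(s+1), ..., Q_t)
   and contains every other Q_j with j <= s, then merging colours s+1, ..., t
   into colour i turns a colouring of G with no Q_j in colour j into an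
   s-colouring with no monochromatic H. Containment is a second moment
   argument, so the point is the random asymmetric Ramsey property of H.

   Let q = n^(-1/m_r(Q_(s+1))) and D = n^r q. Draw M = Lambda D independent
   uniform copies of T in K_n (Lambda a large constant). A colouring of their
   union with no T in colour i has in each of the M copies an edge of colour
   > s, and these chosen edges contain no Q_j in colour j > s. By the container
   theorem they lie in a container determined by O(D) of them, while by Ramsey's
   theorem each container misses a positive proportion of all copies of T. So
   the union bound gives probability exp(-cM) for the M copies to be bad; only
   O(D) = O(M / Lambda) indices have to be guessed, hence no logarithm is lost.
   To pass to H, count M-tuples of edge-disjoint copies of T inside H: by
   Chebyshev and Markov there are typically at least ((1 - eps) E X)^M of them,
   X being the number of copies of T, while the expected number of bad ones is
   at most (E X)^M exp(-cM). The definition of m_r(T, Q_(s+1)) is exactly what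
   makes E X / (number of copies meeting a given one) much larger than D. *)
Require Import Defs.
From HB Require Import structures.
From mathcomp Require Import all_boot all_order all_algebra.
From mathcomp Require Import boolp lra ring zify reals exp.

Set Implicit Arguments.
Unset Strict Implicit.
Unset Printing Implicit Defensive.

Import Order.TTheory GRing.Theory Num.Theory.

Local Open Scope ring_scope.

(** * Hypergraph containers *)

(* A decision tree that queries the membership of vertices in an unknown set
   [I] and ends with a container of [I] satisfying [P]. Only positive answers
   are charged to the budget [b]: they form the fingerprint of [I], which
   determines the leaf (see [covered_container]). *)
Inductive covered (R : archiRealFieldType) (V : finType) (P : {set V} -> Prop) :
    R -> ({set V} -> Prop) -> Prop :=
| covered_leaf (b : R) (fam : {set V} -> Prop) (C : {set V}) : 0 <= b ->
    (forall I : {set V}, fam I -> (I \subset C) /\ P C) -> covered P b fam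
| covered_query (b : R) (fam : {set V} -> Prop) (v : V) :
    covered P b (fun I => fam I /\ v \notin I) ->
    covered P (b - 1) (fun I => fam I /\ v \in I) -> covered P b fam.

Section DecisionTrees.
Variables (R : archiRealFieldType) (V : finType).
Implicit Types (P fam : {set V} -> Prop) (b : R) (C I S : {set V}).

Lemma covered_sub P b b' fam fam' : covered P b fam -> b <= b' ->
  (forall I, fam' I -> fam I) -> covered P b' fam'.
Proof.
move=> cov; elim: cov b' fam' => {b fam} [b fam C b0 leaf|b fam v _ IHn _ IHy] b' fam' le_b sub.
  by apply: (covered_leaf (C := C)) => [|I /sub]; [exact: le_trans le_b | exact: leaf].
apply: (covered_query (v := v)).
  by apply: IHn => // I [/sub].
by apply: IHy => [|I [/sub]//]; rewrite lerD2r.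
Qed.

Lemma covered_empty P b fam : 0 <= b -> (forall I, ~ fam I) -> covered P b fam.
Proof. by move=> b0 none; apply: (covered_leaf (C := set0)) => // I /none. Qed.

Lemma covered_bind P P' b b' fam : 0 <= b' -> covered P b fam ->
  (forall C, P C -> covered P' b' (fun I => fam I /\ I \subset C)) ->
  covered P' (b + b') fam.
Proof.
move=> b'0 cov; elim: cov => {b fam} [b fam C b0 leaf|b fam v _ IHn _ IHy] next.
  (* A leaf guarantees [P C] only if some [I] reaches it, so an unreachable leaf is closed
     separately. *)
  have [[I /leaf[_ PC]]|none] := pselect (exists I, fam I).
    apply: covered_sub (next _ PC) _ _; first by rewrite lerDr.
    by move=> J famJ; split=> //; have [] := leaf J famJ.
  by apply: covered_empty => [|I famI]; [rewrite addr_ge0 | case: none; exists I].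
apply: (covered_query (v := v)).
  by apply: IHn => C /next cov; apply: covered_sub cov _ _ => // I [[]].
rewrite addrAC; apply: IHy => C /next cov.
by apply: covered_sub cov _ _ => // I [[]].
Qed.

(* [Y] collects the vertices already known to lie in [I]: excluding them from
   the fingerprint makes it a plain set although a vertex may be queried twice. *)
Lemma covered_container P b fam : covered P b fam -> forall Y : {set V},
  exists cont : {set V} -> {set V}, forall I, fam I -> Y \subset I ->
  exists S, [/\ S \subset I :\: Y, #|S|%:R <= b, I \subset cont S & P (cont S)].
Proof.
elim=> {b fam} [b fam C b0 leaf|b fam v _ IHn _ IHy] Y.
  exists (fun=> C) => I /leaf[IC PC] _; exists set0.
  by split; rewrite ?sub0set ?cards0.
have [vY|vY] := boolP (v \in Y).
  have [cont contP] := IHy Y; exists cont => I famI YI.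
  have [|S [SI Sb IS PS]] := contP I _ YI; first by split=> //; exact: subsetP YI _ vY.
  by exists S; split=> //; lra.
have [conty contyP] := IHy (v |: Y); have [contn contnP] := IHn Y.
exists (fun S => if v \in S then conty (S :\ v) else contn S) => I famI YI.
have [vI|vI] := boolP (v \in I); last first.
  have [S [SI Sb IS PS]] := contnP I (conj famI vI) YI.
  exists S; have vS : v \notin S.
    by apply: contra vI => /(subsetP SI); rewrite inE => /andP[].
  by rewrite (negbTE vS).
have [||S [SI Sb IS PS]] := contyP I; [by [] | by rewrite subUset sub1set vI|].
have vS : v \notin S.
  by apply/negP => /(subsetP SI); rewrite !inE eqxx.
exists (v |: S); rewrite setU11 setU1K //; split=> //; last first.
  by rewrite cardsU1 vS add1n -natr1; lra.
rewrite subUset sub1set inE vY vI /=; apply: subset_trans SI _.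
by apply: setDS; exact: subsetUr.
Qed.

End DecisionTrees.

(** * Weighted hypergraphs: degrees, independent sets, codegree condition *)

Section Weights.
Variables (R : archiRealFieldType) (V : finType).
Implicit Types (w : {set V} -> R) (I J E A : {set V}).

Definition wdeg w J := \sum_(E : {set V} | J \subset E) w E.

Definition windep w I := forall E, 0 < w E -> ~~ (E \subset I).

(** The codegree condition of the container method for a weight of total order 1. With [D] of order
    [|V| q], its case [#|J| = 1] bounds each vertex degree by a constant times the average. *)
Definition spread (K D q : R) w :=
  forall J, J != set0 -> wdeg w J <= K / D * q ^+ #|J|.

Lemma wdeg_ge0 w J : (forall E, 0 <= w E) -> 0 <= wdeg w J.
Proof. by move=> w0; apply: sumr_ge0. Qed.

Lemma reindex_setU1 (x : V) (f : {set V} -> R) (p : pred {set V}) :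
  \sum_(A : {set V} | (x \notin A) && p (x |: A)) f (x |: A) =
  \sum_(E : {set V} | (x \in E) && p E) f E.
Proof.
rewrite [RHS](reindex_onto (fun A => x |: A) (fun E => E :\ x)) /=.
  apply: eq_bigl => A; rewrite setU11 /=.
  have [xA|xA] := boolP (x \in A) => /=.
    rewrite [_ == _](_ : _ = false) ?andbF //; apply/negP => /eqP/setP/(_ x).
    by rewrite xA !inE eqxx.
  by rewrite setU1K // eqxx andbT.
by move=> E /andP[xE _]; exact: setD1K.
Qed.

End Weights.

(** * One round of the container algorithm *)

Section Round.
Variables (R : archiRealFieldType) (V : finType) (w : {set V} -> R).
Variables (U : {set V}) (q D K : R) (l : nat).
Hypotheses (q0 : 0 < q) (q_small : 64 * K ^+ 2 * q <= 1) (D1 : 1 <= D) (K1 : 1 <= K).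
Hypothesis VqKD : #|V|%:R * q <= K * D.
Hypothesis w0 : forall E, 0 <= w E.
Hypothesis wU : forall E, 0 < w E -> E \subset U /\ (#|E| <= l.+1)%N.
Hypothesis w_spread : spread K D q w.
Hypothesis w_total : 1 <= \sum_E w E.
Hypothesis w_empty : w set0 = 0.
Implicit Types (u : {set V} -> R) (I J E A S C : {set V}).

(** The factor is chosen so that [K / K' * 2 ^+ l = 1/8], which bounds the weight lost to saturated
    sets. *)
Let K' : R := 8 * 2 ^+ l * K.

Let K_gt0 : 0 < K. Proof. exact: lt_le_trans K1. Qed.
Let D_gt0 : 0 < D. Proof. exact: lt_le_trans D1. Qed.

(* One round of the container algorithm. The weight [u] lives on sets one
   element smaller than [w]: whenever a queried vertex [x] is in [I], the link
   of [x] in [w], scaled by [1 / q], is added to [u], except for sets containing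
   a saturated [J]. Both [w] and [u] stay independent of [I]. *)
Definition sat u J := (J != set0) && (K' / D * q ^+ #|J| <= wdeg u J).
Definition unsat u A := ~~ [exists J : {set V}, (J \subset A) && sat u J].
Definition gain u x := \sum_(A : {set V} | (x \notin A) && unsat u A) w (x |: A).
(** The threshold serves twice: all light vertices together gain at most 1/8, while a positive
    answer at a heavy vertex raises the total of [u] by at least [1 / (8 * K * D)]. *)
Definition light u x := gain u x < q / (8 * K * D).
Definition grow u x A := u A + (if (x \notin A) && unsat u A then w (x |: A) / q else 0).

Lemma wdeg_le u u' J : (forall E, u E <= u' E) -> wdeg u J <= wdeg u' J.
Proof. by move=> le_u; apply: ler_sum. Qed.

Lemma le_grow u x A : u A <= grow u x A.
Proof.
rewrite /grow lerDl; case: ifP => // _.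
by rewrite divr_ge0 // ltW.
Qed.

Lemma unsat_le u u' A : (forall E, u E <= u' E) -> unsat u' A -> unsat u A.
Proof.
move=> le_u; apply: contra => /existsP[J /andP[JA /andP[J0 sJ]]].
apply/existsP; exists J; rewrite JA /sat J0 /=.
exact: le_trans sJ (wdeg_le _ le_u).
Qed.

(** Saturated sets stay saturated as [u] grows, so gains only decrease. Hence a vertex passed over
    as light is still light at the leaf. *)
Lemma light_le u u' x : (forall E, u E <= u' E) -> light u x -> light u' x.
Proof.
move=> le_u; apply: le_lt_trans; rewrite /gain big_mkcond [leRHS]big_mkcond /=.
apply: ler_sum => A _; case: (x \notin A) => //=.
have [/(unsat_le le_u)->//|_] := boolP (unsat u' A); by case: ifP.
Qed.

Lemma grow_total u x : \sum_A grow u x A = \sum_A u A + gain u x / q.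
Proof. by rewrite big_split /= -big_mkcond /= mulr_suml. Qed.

(** A saturated [J] receives nothing more. An unsaturated [J] is below [K' / D * q ^+ #|J|], and one
    step adds at most [wdeg w (x |: J) / q], which the spread of [w] bounds by [K / D * q ^+ #|J|];
    nothing is added if [x] is in [J]. *)
Lemma grow_spread u x : spread (K' + K) D q u -> spread (K' + K) D q (grow u x).
Proof.
move=> u_spread J J0; have [sJ|nsJ] := boolP (sat u J).
  rewrite [leLHS](_ : _ = wdeg u J); first exact: u_spread.
  apply: eq_bigr => E JE; rewrite /grow [X in if X then _ else _](_ : _ = false) ?addr0 //.
  apply/negP => /andP[_ /negP[]]; apply/existsP; exists J; by rewrite JE.
rewrite /wdeg big_split /= !mulrDl lerD //.
  by move: nsJ; rewrite /sat J0 /= -ltNge => /ltW.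
rewrite -big_mkcondr /=.
have [xJ|xJ] := boolP (x \in J).
  rewrite big_pred0; last first.
    by move=> A; case: (boolP (J \subset A)) => // /subsetP/(_ x xJ) ->.
  by rewrite ltW // !mulr_gt0 ?invr_gt0 ?exprn_gt0.
rewrite -mulr_suml ler_pdivrMr //.
apply: (@le_trans _ _ (wdeg w (x |: J))); last first.
  apply: le_trans (w_spread _) _.
    by apply/set0Pn; exists x; rewrite setU11.
  by rewrite cardsU1 xJ add1n exprSr mulrA.
apply: (@le_trans _ _ (\sum_(A : {set V} | (x \notin A) && (x |: J \subset x |: A)) w (x |: A))).
  rewrite big_mkcond [leRHS]big_mkcond; apply: ler_sum => A _.
  have [/and3P[JA xA _]|_] := ifP; last by case: ifP.
  by rewrite xA setUS.
rewrite (reindex_setU1 _ _ (fun E => x |: J \subset E)) big_mkcond [leRHS]big_mkcond /=.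
apply: ler_sum => A _; have [|_] := boolP (x |: J \subset A); last by rewrite andbF.
by rewrite andbT; case: ifP.
Qed.

(* Every edge of [w] inside the container contains a saturated set, meets [S],
   or consists of light vertices; each kind carries little weight. *)
Lemma leaf_container u S : (forall A, 0 <= u A) -> (forall A, 0 < u A -> (#|A| <= l)%N) ->
  \sum_A u A <= 1 -> #|S|%:R <= 8 * K * D ->
  D / (2 * K * q) <= #|U :\: (S :|: [set x | light u x])|%:R.
Proof.
move=> u0 ul u_total S_small; set L := [set x | _]; set C := S :|: L.
have vdeg v : wdeg w [set v] <= K / D * q.
  by have := w_spread (J := [set v]); rewrite cards1 expr1; apply; apply/set0Pn; exists v; rewrite set11.
have card_bound (X : {set V}) : \sum_(v in X) wdeg w [set v] <= #|X|%:R * (K / D * q).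
  apply: le_trans (ler_sum _ (fun v _ => vdeg v)) _.
  by rewrite sumr_const mulr_natl.
have K'0 : 0 < K' by rewrite !mulr_gt0 ?exprn_gt0.
(* The total is at least 1 and the last three terms come to at most 3/8, so the vertices of [U]
   outside [C] carry at least 1/2, each of them at most [K / D * q]. *)
suff main : \sum_E w E <= #|U :\: C|%:R * (K / D * q) + #|S|%:R * (K / D * q) + 1/8 + 1/8.
  have : 1/2 <= #|U :\: C|%:R * (K / D * q).
    have : #|S|%:R * (K / D * q) <= 1/8.
      apply: (@le_trans _ _ (8 * K * D * (K / D * q))).
        by rewrite ler_wpM2r // mulr_ge0 ?divr_ge0 ?(ltW q0) ?(ltW K_gt0) ?(ltW D_gt0).
      rewrite (_ : _ * _ = (64 * K ^+ 2 * q) / 8); last by field; rewrite gt_eqF.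
      by rewrite ler_pM2r ?invr_gt0.
    have := w_total; lra.
  move=> half; rewrite ler_pdivrMr ?mulr_gt0 //.
  have -> : D = (1/2) * (2 * D) by field.
  rewrite (_ : _ * (2 * K * q) = #|U :\: C|%:R * (K / D * q) * (2 * D)); last by field; rewrite gt_eqF.
  by rewrite ler_wpM2r // mulr_ge0 ?(ltW D_gt0).
(* The [w]-degree of a saturated [J] is at most [K / K'] times its [u]-degree, and summing
   [u]-degrees over all [J] counts each edge of [u] at most [2 ^+ l] times. *)
have sat_sum : \sum_(J | sat u J) wdeg w J <= 1/8.
  apply: (@le_trans _ _ (\sum_(J | sat u J) K / K' * wdeg u J)).
    apply: ler_sum => J /andP[J0 sJ]; apply: le_trans (w_spread J0) _.
    have -> : K / D * q ^+ #|J| = K / K' * (K' / D * q ^+ #|J|) by field; rewrite !gt_eqF.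
    by rewrite ler_wpM2l // divr_ge0 // ltW.
  rewrite -mulr_sumr; apply: (@le_trans _ _ (K / K' * 2 ^+ l)); last first.
    rewrite le_eqVlt; apply/orP; left; apply/eqP; rewrite /K'; field.
    by rewrite expf_neq0 ?gt_eqF.
  rewrite ler_wpM2l //; first by rewrite divr_ge0 // ltW.
  apply: (@le_trans _ _ (\sum_(J : {set V}) wdeg u J)).
    rewrite big_mkcond; apply: ler_sum => J _; case: ifP => // _; exact: wdeg_ge0.
  rewrite /wdeg; under eq_bigr do rewrite big_mkcond.
  rewrite exchange_big /=; apply: (@le_trans _ _ (\sum_(A : {set V}) 2 ^+ l * u A)).
    apply: ler_sum => A _; rewrite -big_mkcond /= sumr_const -[leLHS]mulr_natl.
    have [uA|] := ltP 0 (u A); last first.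
      move=> uA; have -> : u A = 0 by apply/eqP; rewrite eq_le uA u0.
      by rewrite !mulr0.
    rewrite ler_wpM2r //.
    have -> : #|[pred J : {set V} | J \subset A]| = (2 ^ #|A|)%N.
      by rewrite -card_powerset; apply: eq_card => J; rewrite !inE.
    by rewrite natrX ler_weXn2l ?ler1n // ul.
  rewrite -mulr_sumr -[leRHS]mulr1 ler_wpM2l // exprn_ge0 //.
have light_sum : \sum_(v in L) gain u v <= 1/8.
  apply: (@le_trans _ _ (\sum_(v in L) q / (8 * K * D))).
    by apply: ler_sum => v; rewrite inE => /ltW.
  rewrite sumr_const -[leLHS]mulr_natl.
  apply: (@le_trans _ _ (#|V|%:R * (q / (8 * K * D)))).
    by rewrite ler_wpM2r ?ler_nat ?max_card // divr_ge0 ?(ltW q0) // ltW // !mulr_gt0.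
  rewrite mulrA ler_pdivrMr ?mulr_gt0 //; have := VqKD; lra.
have pointwise E : w E <= \sum_(v in U :\: C) (if [set v] \subset E then w E else 0)
    + \sum_(v in S) (if [set v] \subset E then w E else 0)
    + \sum_(J | sat u J) (if J \subset E then w E else 0)
    + \sum_(v in L) (if (v \in E) && unsat u (E :\ v) then w E else 0).
  have ge0 (T : finType) (p c : pred T) : 0 <= \sum_(v | p v) (if c v then w E else 0).
    by apply: sumr_ge0 => v _; case: ifP.
  have ge1 (T : finType) (p c : pred T) x : p x -> c x ->
      w E <= \sum_(v | p v) (if c v then w E else 0).
    move=> px cx; rewrite (bigD1 x) //= cx lerDl.
    by apply: sumr_ge0 => v _; case: ifP.
  have [/existsP[v /andP[vE vUC]]|/existsPn noUC] :=
      boolP [exists v, (v \in E) && (v \in U :\: C)].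
    have := ge1 _ _ (fun v => [set v] \subset E) v vUC.
    rewrite sub1set => /(_ vE) le1; rewrite -!addrA (le_trans le1) // lerDl.
    by rewrite !addr_ge0.
  have [/existsP[v /andP[vE vS]]|/existsPn noS] := boolP [exists v, (v \in E) && (v \in S)].
    have := ge1 _ _ (fun v => [set v] \subset E) v vS.
    rewrite sub1set => /(_ vE) le1; rewrite -!addrA addrCA (le_trans le1) // lerDl.
    by rewrite !addr_ge0.
  have [/existsP[J /andP[JE sJ]]|nosat] := boolP [exists J : {set V}, (J \subset E) && sat u J].
    have le1 := ge1 _ _ (fun J : {set V} => J \subset E) J sJ JE.
    rewrite addrAC addrC (le_trans le1) // lerDl.
    by rewrite !addr_ge0.
  have [wE|wE] := ltP 0 (w E); last first.
    apply: le_trans wE _; by rewrite !addr_ge0.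
  have [EU _] := wU wE.
  have /set0Pn[v vE] : E != set0.
    by apply: contraTneq wE => ->; rewrite w_empty ltxx.
  have vL : v \in L.
    have := noUC v; have := noS v; rewrite vE /= !inE (subsetP EU) // andbT negbK.
    by move=> /negbTE ->.
  have := ge1 _ _ (fun v => (v \in E) && unsat u (E :\ v)) v vL.
  rewrite vE /= => le1; apply: le_trans (le1 _) _; last by rewrite lerDr !addr_ge0.
  apply: contra nosat => /existsP[J /andP[JE sJ]]; apply/existsP; exists J.
  by rewrite sJ (subset_trans JE) // subD1set.
apply: le_trans (ler_sum _ (fun E _ => pointwise E)) _.
rewrite !big_split /= !lerD //; rewrite exchange_big /=.
- apply: le_trans (card_bound _); apply: ler_sum => v _; by rewrite /wdeg [leRHS]big_mkcond.
- apply: le_trans (card_bound _); apply: ler_sum => v _; by rewrite /wdeg [leRHS]big_mkcond.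
- apply: le_trans sat_sum; apply: ler_sum => J _; by rewrite /wdeg [leRHS]big_mkcond.
apply: le_trans light_sum; apply: ler_sum => v _.
rewrite -big_mkcond /= -(reindex_setU1 v w (fun E => unsat u (E :\ v))).
rewrite /gain big_mkcond [leRHS]big_mkcond; apply: ler_sum => A _.
have [/andP[vA uA]|_] := ifP; last by case: ifP.
by rewrite vA /=; move: uA; rewrite setU1K // => ->.
Qed.

(** The vertices are scanned once; light ones enter the container unqueried. Either the scan ends
    with the total of [u] below 1, and [leaf_container] applies, or the total reaches 1 and [u], of
    smaller uniformity, is handed to the next round. *)
Lemma round_covered (P : {set V} -> Prop) (B : R) : 0 <= B ->
  (forall C, D / (2 * K * q) <= #|U :\: C|%:R -> P C) ->
  (forall u, (forall A, 0 <= u A) -> (forall A, 0 < u A -> A \subset U /\ (#|A| <= l)%N) ->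
    1 <= \sum_A u A -> spread (K' + K) D q u -> covered P B (windep u)) ->
  covered P (8 * K * D + 1 + B) (windep w).
Proof.
move=> B0 leafP nextP.
have KD0 : 0 < 8 * K * D by rewrite !mulr_gt0.
(* Invariant: [s] is still to be scanned and [S] holds the positive answers so far. The budget is
   proportional to what the total of [u] lacks to 1; the extra 1 pays for the query that
   overshoots. *)
suff gen (s : seq V) u S (fam : {set V} -> Prop) :
    (forall A, 0 <= u A) -> (forall A, 0 < u A -> A \subset U /\ (#|A| <= l)%N) ->
    \sum_A u A < 1 -> spread (K' + K) D q u ->
    #|S|%:R <= 8 * K * D * \sum_A u A ->
    (forall I, fam I -> windep u I /\ windep w I) ->
    (forall I, fam I -> forall x, x \in I -> [|| x \in S, light u x | x \in s]) ->
    covered P ((1 - \sum_A u A) * (8 * K * D) + 1 + B) fam.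
  have sum0 : \sum_(A : {set V}) (0 : R) = 0 by rewrite big1.
  have := gen (enum V) (fun=> 0) set0 (windep w); rewrite sum0 subr0 mul1r; apply.
  - by [].
  - by move=> A; rewrite ltxx.
  - exact: ltr01.
  - move=> J _; rewrite /wdeg big1 // mulr_ge0 ?exprn_ge0 ?ltW //.
    by rewrite !mulr_gt0 ?invr_gt0 ?addr_gt0 ?mulr_gt0 ?exprn_gt0.
  - by rewrite cards0 mulr0.
  - by move=> I indI; split=> // E; rewrite ltxx.
  by move=> I _ x _; rewrite mem_enum !orbT.
elim: s u S fam => [|x s IHs] u S fam u0 uU u1 u_spread uS fam_ind fam_sub.
  apply: (covered_leaf (C := S :|: [set x | light u x])).
    by rewrite !addr_ge0 // mulr_ge0 ?(ltW KD0) // subr_ge0 ltW.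
  move=> I famI; split.
    apply/subsetP => x xI; have := fam_sub I famI x xI.
    by rewrite !inE orbF.
  apply/leafP/leaf_container => //; first by move=> A /uU[].
    exact: ltW.
  apply: le_trans uS _; rewrite -[leRHS]mulr1 ler_wpM2l // ltW //.
have [lx|hx] := boolP (light u x).
  apply: (IHs u S) => // I famI y yI; have := fam_sub I famI y yI.
  by rewrite inE; have [->|_] := eqVneq y x; rewrite ?lx ?orbT.
have gain_x : q / (8 * K * D) <= gain u x by rewrite leNgt.
have gain_total : \sum_A u A + 1 / (8 * K * D) <= \sum_A grow u x A.
  rewrite grow_total lerD2l ler_pdivlMr // (le_trans _ gain_x) //.
  by rewrite mulrC mulrA mulr1.
have grow_ind I : windep u I -> windep w I -> x \in I -> windep (grow u x) I.
  move=> uI wI xI E; rewrite /grow; case: ifP => [/andP[xE _]|_]; last first.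
    by rewrite addr0; exact: uI.
  move=> gE; apply/negP => EI.
  have [uE|uE] := ltP 0 (u E); first by have /negP := uI E uE.
  have wE : 0 < w (x |: E).
    rewrite lt_neqAle w0 andbT eq_sym; apply: contraTneq gE => ->.
    by rewrite mul0r addr0 -leNgt.
  by have /negP[] := wI _ wE; rewrite subUset sub1set xI.
have grow0 A : 0 <= grow u x A by apply: le_trans (le_grow u x A).
have growU A : 0 < grow u x A -> A \subset U /\ (#|A| <= l)%N.
  have [uA _|uA] := ltP 0 (u A); first exact: uU.
  rewrite /grow; case: ifP => [/andP[xA _]|_] gA; last by move: gA; rewrite addr0 ltNge uA.
  have wA : 0 < w (x |: A).
    rewrite lt_neqAle w0 andbT eq_sym; apply: contraTneq gA => ->.
    by rewrite mul0r addr0 -leNgt.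
  have [] := wU wA; rewrite cardsU1 xA add1n ltnS subUset => /andP[_ ->] ->.
  by [].
apply: (covered_query (v := x)).
  apply: (IHs u S) => // [I [/fam_ind//]|I [famI xI] y yI].
  have := fam_sub I famI y yI; rewrite inE; have [yx|_] // := eqVneq y x.
  by rewrite -yx yI in xI.
have inv : 1 / (8 * K * D) * (8 * K * D) = 1 by rewrite mulrAC mulfK ?gt_eqF ?mul1r.
have [big|small] := leP 1 (\sum_A grow u x A).
  apply: covered_sub (nextP _ grow0 growU big (grow_spread x u_spread)) _ _.
    have : 0 <= (1 - \sum_A u A) * (8 * K * D) by rewrite mulr_ge0 ?(ltW KD0) // subr_ge0 ltW.
    lra.
  by move=> I [/fam_ind[uI wI] xI]; exact: grow_ind.
have step := ler_wpM2r (ltW KD0) gain_total.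
rewrite mulrDl inv in step.
apply: covered_sub (IHs (grow u x) (x |: S) (fun I => fam I /\ x \in I) grow0 growU small
  (grow_spread x u_spread) _ _ _) _ _.
- apply: (@le_trans _ _ (1 + #|S|%:R)).
    by rewrite -[1]/(1%:R) -natrD ler_nat cardsU1 leq_add2r leq_b1.
  by rewrite mulrC; lra.
- by move=> I [/fam_ind[uI wI] xI]; split=> //; exact: grow_ind.
- move=> I [famI xI] y yI; have := fam_sub I famI y yI; rewrite !inE.
  have [->|_] //= := eqVneq y x => /or3P[->//|/light_le->|->]; rewrite ?orbT //.
  exact: le_grow.
- lra.
by [].
Qed.

End Round.

(** Induction on the uniformity. At [l = 0] the only possible edge is the empty set, which lies in
    every [I], so no set is independent. Otherwise one round ends with a container or passes on a
    weight spread with constant [K2]. *)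
Lemma shrink_covered (R : archiRealFieldType) (l : nat) (K : R) : 1 <= K ->
  exists B d q0 : R, [/\ 0 <= B, 0 < d, 0 < q0 &
  forall (V : finType) (w : {set V} -> R) (U : {set V}) (q D : R),
    0 < q <= q0 -> 1 <= D -> #|V|%:R * q <= K * D ->
    (forall E, 0 <= w E) -> (forall E, 0 < w E -> E \subset U /\ (#|E| <= l)%N) ->
    spread K D q w -> 1 <= \sum_E w E ->
    covered (fun C => d * D / q <= #|U :\: C|%:R) (B * D) (windep w)].
Proof.
elim: l K => [|l IHl] K K1.
  exists 0, 1, 1; split=> // V w U q D _ _ _ w0 wU _ w1.
  apply: covered_empty => [|I indI]; first by rewrite mul0r.
  have : \sum_E w E != 0 by rewrite gt_eqF // (lt_le_trans ltr01).
  apply/negP; rewrite negbK; apply/eqP; apply: big1 => E _; apply/eqP; rewrite eq_le w0 andbT.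
  have [wE|//] := ltP 0 (w E); have [_] := wU E wE.
  rewrite leqn0 cards_eq0 => /eqP E0; have /negP[] := indI E wE.
  by rewrite E0 sub0set.
have K_gt0 : 0 < K by apply: lt_le_trans K1.
pose K2 := 8 * 2 ^+ l * K + K.
have leK : K <= K2 by rewrite lerDr !mulr_ge0 ?exprn_ge0 // ltW.
have [B [d [q0 [B0 d0 q00 IH]]]] := IHl K2 (le_trans K1 leK).
have K2_gt0 : 0 < 2 * K by rewrite mulr_gt0.
exists (8 * K + 1 + B), (Num.min d (2 * K)^-1), (Num.min q0 (64 * K ^+ 2)^-1).
split.
- by rewrite !addr_ge0 ?mulr_ge0 // ltW.
- by rewrite lt_min d0 invr_gt0.
- by rewrite lt_min q00 invr_gt0 mulr_gt0 // exprn_gt0.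
move=> V w U q D; rewrite le_min => /and3P[qp qq0 qK] D1 VD w0 wU wK w1.
have D0 : 0 < D by apply: lt_le_trans D1.
have BD0 : 0 <= B * D by rewrite mulr_ge0 ?(ltW D0).
have KD0 : 0 <= 8 * K * D by rewrite !mulr_ge0 // ltW.
have [we|we] := ltP 0 (w set0).
  apply: covered_empty => [|I indI].
    by rewrite !mulrDl mul1r; lra.
  by have /negP[] := indI _ we; rewrite sub0set.
have {}we : w set0 = 0 by apply/eqP; rewrite eq_le we w0.
have Dq C e : e <= d -> d * D / q <= #|U :\: C|%:R -> e * D / q <= #|U :\: C|%:R.
  by move=> ed; apply: le_trans; rewrite !ler_wpM2r ?invr_ge0 ?(ltW qp) ?(ltW D0).
apply: covered_sub (round_covered qp _ D1 K1 VD w0 wU wK w1 we BD0 _ _) _ _.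
- rewrite mulrC -ler_pdivlMr ?mulr_gt0 ?exprn_gt0 // ?div1r //.
- move=> C; apply: le_trans; rewrite (_ : D / (2 * K * q) = (2 * K)^-1 * D / q); last first.
    by field; rewrite !gt_eqF.
  by rewrite !ler_wpM2r ?invr_ge0 ?(ltW qp) ?(ltW D0) // ge_min lexx orbT.
- move=> u u0 uU u1 uK.
  have := IH V u U q D; rewrite qp qq0; move=> /(_ isT D1 _ u0 uU uK u1) cov.
  have {}cov := cov (le_trans VD (ler_wpM2r (ltW D0) leK)).
  elim: cov => [b fam C b0 leaf|b fam v _ IHn _ IHy].
    apply: (covered_leaf (C := C)) => // I /leaf[IC dC]; split=> //.
    by apply: Dq dC; rewrite ge_min lexx.
  exact: covered_query IHn IHy.
- by rewrite !mulrDl mul1r; lra.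
by [].
Qed.

(** As long as the container holds weight above [eps], the restricted weight divided by [eps] has
    total at least 1 and can be shrunk again. Each pass removes [d * D / q] vertices out of at most
    [K * D / q], so a constant number [N] of passes suffices. *)
Theorem containers (R : archiRealFieldType) (l : nat) (K eps : R) : 1 <= K -> 0 < eps ->
  exists B q0 : R, [/\ 0 <= B, 0 < q0 &
  forall (V : finType) (w : {set V} -> R) (q D : R),
    0 < q <= q0 -> 1 <= D -> #|V|%:R * q <= K * D ->
    (forall E, 0 <= w E) -> (forall E, 0 < w E -> (#|E| <= l)%N) ->
    spread K D q w ->
    covered (fun C => \sum_(E : {set V} | E \subset C) w E <= eps) (B * D) (windep w)].
Proof.
move=> K1 eps0; have K_gt0 : 0 < K by apply: lt_le_trans K1.
pose K2 := K + K / eps.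
have K2K : K <= K2 by rewrite lerDl divr_ge0 // ltW.
have K2e : K / eps <= K2 by rewrite lerDr ltW.
have [B [d [q0 [B0 d0 q00 shrink]]]] := shrink_covered l (le_trans K1 K2K).
pose N := Num.bound (K / d).
have NK : K <= N%:R * d.
  rewrite -ler_pdivrMr // ltW // archi_boundP //.
  by rewrite divr_ge0 // ltW.
exists (N%:R * B), q0; split=> //; first by rewrite mulr_ge0.
move=> V w q D /andP[qp qq0] D1 VD w0 wl wK.
have D0 : 0 < D by apply: lt_le_trans D1.
suff gen (i : nat) (C0 : {set V}) : #|C0|%:R <= i%:R * (d * D / q) ->
    covered (fun C => \sum_(E : {set V} | E \subset C) w E <= eps) (i%:R * B * D)
      (fun I => windep w I /\ I \subset C0).
  apply: covered_sub (gen N setT _) _ _ => //.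
  rewrite cardsT mulrA ler_pdivlMr // (le_trans VD) // mulrA.
  by rewrite ler_wpM2r // ltW.

elim: i C0 => [|i IHi] C0 C0i.
  have {C0i} -> : C0 = set0.
    by apply/eqP; rewrite -cards_eq0 -leqn0 -(ler_nat R) (le_trans C0i) ?mul0r.
  rewrite !mul0r.
  have [small|big] := leP (\sum_(E : {set V} | E \subset set0) w E) eps.
    by apply: (covered_leaf (C := set0)) => // I [].
  apply: covered_empty => // I [indI _].
  have {}big : 0 < w set0.
    apply: lt_le_trans eps0 _; rewrite (le_trans (ltW big)) // (eq_bigl (pred1 set0)) ?big_pred1_eq //.
    by move=> E; rewrite subset0.
  by have /negP[] := indI _ big; rewrite sub0set.
have b0 (k : nat) : 0 <= k%:R * B * D by rewrite !mulr_ge0 ?(ltW D0).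
have [small|big] := leP (\sum_(E : {set V} | E \subset C0) w E) eps.
  by apply: (covered_leaf (C := C0)) => // I [].
(* Renormalising costs a factor [1 / eps] in the spread constant, whence the term [K / eps] in
   [K2]. *)
pose u (E : {set V}) := if E \subset C0 then w E / eps else 0.
have u0 E : 0 <= u E by rewrite /u; case: ifP => // _; rewrite divr_ge0 ?(ltW eps0).
have uw E : 0 < u E -> 0 < w E /\ E \subset C0.
  by rewrite /u; case: ifP => [EC|_]; rewrite ?ltxx // pmulr_lgt0 // invr_gt0.
have cov : covered (fun C => d * D / q <= #|C0 :\: C|%:R) (B * D) (windep u).
  apply: (shrink _ _ _ q D) => //; first by rewrite qp.
  - by rewrite (le_trans VD) // ler_wpM2r // ltW.
  - by move=> E /uw[/wl].
  - move=> J J0; apply: (@le_trans _ _ (wdeg w J / eps)).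
      rewrite /wdeg mulr_suml; apply: ler_sum => E _; rewrite /u.
      by case: ifP => // _; rewrite divr_ge0 // ltW.
    rewrite ler_pdivrMr // (le_trans (wK J J0)) //.
    rewrite [leRHS]mulrAC ler_wpM2r ?exprn_ge0 ?(ltW qp) //.
    rewrite [leRHS]mulrAC ler_wpM2r ?invr_ge0 ?(ltW D0) //.
    by rewrite -ler_pdivrMr.
  by rewrite -big_mkcond /= -mulr_suml ler_pdivlMr // mul1r ltW.
have -> : i.+1%:R * B * D = B * D + i%:R * B * D by rewrite -natr1; ring.
apply: covered_bind (b0 i) (covered_sub cov (lexx _) _) _.
  move=> I [indI _] E /uw[wE _]; exact: indI.
move=> C dC; apply: covered_sub (IHi (C0 :&: C) _) (lexx _) _.
  have : #|C0|%:R = #|C0 :&: C|%:R + #|C0 :\: C|%:R :> R by rewrite -natrD cardsID.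
  move: C0i; rewrite -natr1 mulrDl mul1r; lra.
by move=> I [[indI IC0] IC]; split=> //; rewrite subsetI IC0.
Qed.

(** * Disjoint tuples in the binomial random set *)

Section FfunCons.
Variable T : finType.

Definition fcons n (x : T) (f : {ffun 'I_n -> T}) : {ffun 'I_n.+1 -> T} :=
  [ffun i => if unlift ord0 i is Some j then f j else x].

Lemma fcons0 n x (f : {ffun 'I_n -> T}) : fcons x f ord0 = x.
Proof. by rewrite ffunE unlift_none. Qed.

Lemma fconsS n x (f : {ffun 'I_n -> T}) i : fcons x f (lift ord0 i) = f i.
Proof. by rewrite ffunE liftK. Qed.

Lemma fcons_inj n x : injective (@fcons n x).
Proof. by move=> f h fh; apply/ffunP => i; rewrite -(fconsS x f) fh fconsS. Qed.

Variable c : rel T.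
Hypothesis c_sym : symmetric c.

Definition free_tuples M (W : {set T}) := [set t : {ffun 'I_M -> T} |
  [forall i, t i \in W] && [forall i, forall j, (i != j) ==> ~~ c (t i) (t j)]].

Lemma free_tuplesP M (W : {set T}) (t : {ffun 'I_M -> T}) :
  reflect ((forall i, t i \in W) /\ forall i j, i != j -> ~~ c (t i) (t j))
    (t \in free_tuples M W).
Proof.
rewrite inE; apply: (iffP andP) => [[/forallP tW /forallP tc]|[tW tc]]; split=> //.
- by move=> i j; move: (tc i) => /forallP/(_ j)/implyP.
- exact/forallP.
by apply/forallP => i; apply/forallP => j; apply/implyP/tc.
Qed.

(** Coordinates are chosen one at a time: each choice rules out at most [d] elements, so at least
    [y] candidates remain at every one of the [M] steps. *)
Lemma free_tuples_greedy (R : realFieldType) (y d : R) M (W : {set T}) : 0 <= y -> 0 <= d ->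
  (forall x, x \in W -> #|[set z in W | c x z]|%:R <= d) ->
  y + M%:R * d <= #|W|%:R -> y ^+ M <= #|free_tuples M W|%:R.
Proof.
move=> y0 d0; elim: M W => [|M IHM] W Wd yW.
  rewrite expr0 -[1]/(1%:R) ler_nat card_gt0; apply/set0Pn.
  have f : 'I_0 -> T by case.
  by exists (finfun f); apply/free_tuplesP; split=> [[]|[]].
have yW' : y <= #|W|%:R by apply: le_trans yW; rewrite lerDl mulr_ge0.
rewrite -sum1_card (partition_big (fun t : {ffun 'I_M.+1 -> T} => t ord0) (mem W)) /=; last first.
  by move=> t /free_tuplesP[].
rewrite natr_sum; apply: (@le_trans _ _ (\sum_(x in W) y ^+ M)).
  by rewrite sumr_const exprS -[leRHS]mulr_natl ler_wpM2r // exprn_ge0.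
apply: ler_sum => x xW; rewrite sum1_card.
apply: (@le_trans _ _ #|free_tuples M (W :\: [set z in W | c x z])|%:R).
  apply: IHM => [z|].
    rewrite inE => /andP[_ /Wd]; apply: le_trans; rewrite ler_nat; apply/subset_leq_card/subsetP => u.
    by rewrite !inE => /andP[/andP[_ ->] ->].
  have : #|W|%:R = #|W :&: [set z in W | c x z]|%:R + #|W :\: [set z in W | c x z]|%:R :> R.
    by rewrite -natrD cardsID.
  have := Wd x xW; rewrite (setIidPr _); last by apply/subsetP => z; rewrite inE => /andP[].
  by move: yW; rewrite -natr1 mulrDl mul1r; lra.
rewrite ler_nat -(card_imset _ (@fcons_inj M x)).
apply/subset_leq_card/subsetP => _ /imsetP[t /free_tuplesP[tW tc] ->].
rewrite unfold_in /= fcons0 eqxx andbT.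
have tWc i : t i \in W /\ ~~ c x (t i).
  by have := tW i; rewrite !inE; case: (t i \in W); rewrite ?andbF //= andbT.
apply/free_tuplesP; split=> [i|i j].
  by case: (unliftP ord0 i) => [i'|] ->; rewrite ?fcons0 ?fconsS //; case: (tWc i').
case: (unliftP ord0 i) => [i'|] ->; case: (unliftP ord0 j) => [j'|] ->; rewrite ?fcons0 ?fconsS ?eqxx //.
- by rewrite (inj_eq lift_inj); exact: tc.
- by rewrite c_sym; case: (tWc i').
- by case: (tWc j').
Qed.

End FfunCons.

Section BinomialRandomSet.
Variables (R : realFieldType) (X : finType) (p : R).
Hypothesis p01 : 0 < p <= 1.

Definition prw (A : {set X}) : R := p ^+ #|A| * (1 - p) ^+ #|~: A|.

Let p_gt0 : 0 < p. Proof. by case/andP: p01. Qed.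
Let p_ge0 : 0 <= p. Proof. exact: ltW. Qed.

Lemma prw_ge0 A : 0 <= prw A.
Proof.
by rewrite mulr_ge0 ?exprn_ge0 // subr_ge0; case/andP: p01.
Qed.

(** Expanding the product over [x] of [p + 0] for [x] in [B] and [p + (1 - p)] otherwise gives one
    term for each [A], zero unless [A] contains [B]. *)
Lemma sum_prw_sup (B : {set X}) : \sum_(A : {set X} | B \subset A) prw A = p ^+ #|B|.
Proof.
transitivity (\prod_x (p + (if x \in B then 0 else 1 - p))).
  rewrite bigA_distr big_mkcond /=; apply: eq_bigr => A _.
  have [BA|/subsetPn[x xB xA]] := boolP (B \subset A); last first.
    by rewrite (bigD1 x) //= (negbTE xA) xB mul0r.
  transitivity (\prod_x (if x \in A then p else 1 - p)); last first.
    apply: eq_bigr => x _; case: ifP => // /negbT xA; case: ifP => // xB.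
    by rewrite (subsetP BA) in xA.
  rewrite (bigID (mem A)) /=; congr (_ * _).
    by rewrite -prodr_const; apply: eq_bigr => x ->.
  rewrite -prodr_const; apply: eq_big => x; first by rewrite inE.
  by rewrite inE => /negbTE ->.
rewrite (bigID (mem B)) /= [X in _ * X]big1 ?mulr1; last first.
  by move=> x /negbTE ->; rewrite addrC subrK.
by rewrite -prodr_const; apply: eq_bigr => x ->; rewrite addr0.
Qed.

Lemma sum_prw : \sum_(A : {set X}) prw A = 1.
Proof.
by rewrite -(expr0 p) -(cards0 X) -sum_prw_sup; apply: eq_bigl => A; rewrite sub0set.
Qed.

Variables (I : finType) (Phi : {set I}) (g : I -> {set X}) (e : nat).
Hypothesis card_g : forall f, f \in Phi -> #|g f| = e.

Definition copies_in (A : {set X}) := [set f in Phi | g f \subset A].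
Definition meets f h := ~~ [disjoint g f & g h].
Definition mean_copies : R := #|Phi|%:R * p ^+ e.
(** The expected number of ordered pairs of intersecting copies, pairs [f = h] with nonempty image
    included; it dominates the variance of the number of copies. *)
Definition mean_meeting : R :=
  \sum_(f in Phi) \sum_(h in Phi | meets f h) p ^+ #|g f :|: g h|.
Definition meeting_pairs (A : {set X}) :=
  (\sum_(f in copies_in A) #|[set h in copies_in A | meets f h]|)%N.

Let m := mean_copies.

Lemma exp_copies : \sum_A prw A * #|copies_in A|%:R = m.
Proof.
under eq_bigr => A _.
  rewrite -sum1_card natr_sum mulr_sumr big_mkcond /=.
  under eq_bigr => f _ do rewrite inE.
  over.
rewrite exchange_big /= (bigID (mem Phi)) /= [X in _ + X]big1 ?addr0; last first.
  by move=> f /negbTE nf; rewrite big1 // => A _; rewrite nf.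
rewrite /m /mean_copies mulr_natl -sumr_const; apply: eq_bigr => f fPhi.
rewrite -(card_g fPhi) -sum_prw_sup [RHS]big_mkcond; apply: eq_bigr => A _.
by rewrite fPhi mulr1.
Qed.

Lemma exp_pairs (c : rel I) :
  \sum_A prw A * (\sum_(f in copies_in A) #|[set h in copies_in A | c f h]|)%:R =
  \sum_(f in Phi) \sum_(h in Phi | c f h) p ^+ #|g f :|: g h|.
Proof.
under eq_bigr => A _.
  rewrite natr_sum mulr_sumr big_mkcond /=.
  over.
rewrite exchange_big /= [RHS]big_mkcond /=; apply: eq_bigr => f _.
have [fPhi|fPhi] := boolP (f \in Phi); last first.
  by rewrite big1 // => A _; rewrite inE (negbTE fPhi).
under eq_bigr => A _.
  rewrite -sum1_card natr_sum mulr_sumr big_mkcond [X in if _ then X else _]/=.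
  over.
transitivity (\sum_(A : {set X}) \sum_(h in Phi | c f h) if g f :|: g h \subset A then prw A else 0).
  apply: eq_bigr => A _; rewrite inE fPhi /= [RHS]big_mkcond /=.
  have [fA|fA] := boolP (g f \subset A).
    apply: eq_bigr => h _; rewrite !inE subUset fA /= mulr1.
    by case: (h \in Phi); case: (c f h); case: (g h \subset A).
  by rewrite big1 // => h _; rewrite subUset (negbTE fA) /=; case: ifP.
rewrite exchange_big /=; apply: eq_bigr => h _.
by rewrite -sum_prw_sup [RHS]big_mkcond.
Qed.

(** Pairs with disjoint images are present independently, so together they contribute at most
    [m ^+ 2]. *)
Lemma exp_copies_sqr : \sum_A prw A * #|copies_in A|%:R ^+ 2 <= mean_meeting + m ^+ 2.
Proof.
have -> : \sum_A prw A * #|copies_in A|%:R ^+ 2 =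
    \sum_(f in Phi) \sum_(h in Phi) p ^+ #|g f :|: g h|.
  transitivity (\sum_(f in Phi) \sum_(h in Phi | true) p ^+ #|g f :|: g h|); last first.
    by apply: eq_bigr => f _; apply: eq_bigl => h; rewrite andbT.
  rewrite -(exp_pairs (fun _ _ => true)); apply: eq_bigr => A _; congr (_ * _).
  rewrite -natrX expnS expn1 -sum_nat_const; congr _%:R; apply: eq_bigr => f _.
  by apply: eq_card => h; rewrite !inE andbT.
rewrite /mean_meeting.
have -> : m ^+ 2 = \sum_(f in Phi) \sum_(h in Phi) p ^+ (e + e).
  rewrite /m /mean_copies !sumr_const -[RHS]mulr_natl -[p ^+ (e + e) *+ _]mulr_natl.
  by rewrite exprD expr2 mulrACA -!mulrA.
rewrite -big_split /=; apply: ler_sum => f fPhi.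
rewrite (bigID (meets f)) /= lerD2l big_mkcondr; apply: ler_sum => h hPhi.
case: ifP => [|_]; last by rewrite exprn_ge0.
rewrite negbK => dis; rewrite cardsU (card_g fPhi) (card_g hPhi).
by move: dis; rewrite -setI_eq0 => /eqP ->; rewrite cards0 subn0.
Qed.

Hypothesis m_gt0 : 0 < m.
Variables (eta eps : R).
Hypothesis eps_gt0 : 0 < eps.
Hypothesis few_meeting : mean_meeting <= eta * m ^+ 2.

(** Chebyshev's inequality. *)
Lemma few_copies_prob :
  \sum_(A : {set X} | #|copies_in A|%:R < (1 - eps) * m) prw A <= eta / eps ^+ 2.
Proof.
have em : 0 < (eps * m) ^+ 2 by rewrite exprn_gt0 // mulr_gt0.
have -> : eta / eps ^+ 2 = (eta * m ^+ 2) / (eps * m) ^+ 2.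
  by field; rewrite !gt_eqF.
rewrite ler_pdivlMr // mulr_suml.
apply: (@le_trans _ _ (\sum_A prw A * (#|copies_in A|%:R - m) ^+ 2)).
  rewrite big_mkcond; apply: ler_sum => A _; case: ifP => [small|_]; last first.
    by rewrite mulr_ge0 ?prw_ge0 ?sqr_ge0.
  rewrite ler_wpM2l ?prw_ge0 // -[X in _ <= X]sqrrN opprB.
  have le : eps * m <= m - #|copies_in A|%:R by lra.
  have e0 : 0 <= eps * m by apply: mulr_ge0; apply: ltW.
  by rewrite ler_sqr ?nnegrE // (le_trans e0).
rewrite (eq_bigr (fun A => prw A * #|copies_in A|%:R ^+ 2 - (2 * m * (prw A * #|copies_in A|%:R))
     + m ^+ 2 * prw A)); last by move=> A _; ring.
rewrite big_split sumrB /= -!mulr_sumr sum_prw exp_copies.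
have := exp_copies_sqr; have := few_meeting; lra.
Qed.

(** Markov's inequality. *)
Lemma many_meeting_prob (k : R) : 0 < k ->
  \sum_(A : {set X} | k * m ^+ 2 < (meeting_pairs A)%:R) prw A <= eta / k.
Proof.
move=> k0; have km : 0 < k * m ^+ 2 by rewrite mulr_gt0 ?exprn_gt0.
have -> : eta / k = (eta * m ^+ 2) / (k * m ^+ 2).
  by field; rewrite !gt_eqF.
rewrite ler_pdivlMr // mulr_suml; apply: le_trans few_meeting.
rewrite /mean_meeting -exp_pairs big_mkcond /=; apply: ler_sum => A _.
case: ifP => [big|_]; last by rewrite mulr_ge0 ?prw_ge0.
by rewrite ler_wpM2l ?prw_ge0 // ltW.
Qed.

Lemma meets_sym : symmetric meets.
Proof. by move=> f h; rewrite /meets disjoint_sym. Qed.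

Variables (M : nat) (bad : pred {set X}) (theta : R).
Hypothesis M_gt0 : (0 < M)%N.
Hypothesis eps3 : 3 * eps < 1.
(** Disjointness is not imposed here: the bound on their number comes from a union bound over all
    tuples, and only the expectation below restricts to disjoint ones. *)
Definition bad_tuples := [set t : {ffun 'I_M -> I} | [forall i, t i \in Phi] &&
  [exists A : {set X}, bad A && [forall i, g (t i) \subset A]]].
Hypothesis few_bad : #|bad_tuples|%:R <= (theta * #|Phi|%:R) ^+ M.

(** The loss [3 * eps] has three equal sources: the deficit in copies, the copies meeting more than
    [d] others (at most [eps * m], by counting pairs), and the copies ruled out by the greedy choice
    ([M * d = eps * m]). *)
Lemma many_free_tuples A : (1 - eps) * m <= #|copies_in A|%:R ->
  (meeting_pairs A)%:R <= eps ^+ 2 / M%:R * m ^+ 2 ->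
  ((1 - 3 * eps) * m) ^+ M <= #|free_tuples meets M (copies_in A)|%:R.
Proof.
move=> many few; have M0 : 0 < M%:R :> R by rewrite ltr0n.
pose d := eps / M%:R * m.
have d0 : 0 < d by rewrite mulr_gt0 ?divr_gt0.
pose W := [set f in copies_in A | #|[set h in copies_in A | meets f h]|%:R <= d].
apply: (@le_trans _ _ #|free_tuples meets M W|%:R).
  apply: (free_tuples_greedy meets_sym _ (ltW d0)).
  - by rewrite mulr_ge0 ?(ltW m_gt0) // subr_ge0 ltW.
  - move=> f; rewrite inE => /andP[_]; apply: le_trans; rewrite ler_nat.
    apply/subset_leq_card/subsetP => h; rewrite inE => /andP[hW fh].
    by move: hW; rewrite !inE => /andP[-> _].
  have : #|copies_in A :\: W|%:R <= eps * m.
    rewrite -(ler_pM2r d0) [eps * m * d](_ : _ = eps ^+ 2 / M%:R * m ^+ 2); last first.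
      by rewrite /d; field; rewrite gt_eqF.
    apply: le_trans few; rewrite /meeting_pairs natr_sum mulr_natl -sumr_const.
    rewrite big_mkcond [leRHS]big_mkcond; apply: ler_sum => f _.
    rewrite inE [f \in W]inE; case: (f \in copies_in A); last by rewrite andbF.
    by rewrite /= andbT -ltNge; case: ifP => // /ltW.
  have : #|copies_in A|%:R = #|copies_in A :&: W|%:R + #|copies_in A :\: W|%:R :> R.
    by rewrite -natrD cardsID.
  rewrite (setIidPr _); last by apply/subsetP => f; rewrite inE => /andP[].
  have -> : M%:R * d = eps * m by rewrite /d; field; rewrite gt_eqF.
  by move: many; lra.
rewrite ler_nat; apply/subset_leq_card/subsetP => t /free_tuplesP[tW tc].
apply/free_tuplesP; split=> // i; by have := tW i; rewrite inE => /andP[].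
Qed.

Lemma exp_bad_free_tuples :
  \sum_(A | bad A) prw A * #|free_tuples meets M (copies_in A)|%:R <= (theta * m) ^+ M.
Proof.
under eq_bigr => A _.
  rewrite -sum1_card natr_sum mulr_sumr big_mkcond /=.
  under eq_bigr => t _ do rewrite mulr1.
  over.
rewrite exchange_big /=.
apply: (@le_trans _ _ (\sum_(t in bad_tuples) p ^+ (e * M))); last first.
  rewrite sumr_const -[leLHS]mulr_natl exprM /m /mean_copies mulrA [leRHS]exprMn.
  apply: ler_wpM2r; first by rewrite !exprn_ge0.
  exact: few_bad.
rewrite [leRHS]big_mkcond; apply: ler_sum => t _.
have [tbad|nbad] := boolP (t \in bad_tuples); last first.
  rewrite big1 // => A bA; case: ifP => // /free_tuplesP[tW _].
  case/negP: nbad; rewrite inE; apply/andP; split.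
    by apply/forallP => i; have := tW i; rewrite inE => /andP[].
  apply/existsP; exists A; rewrite bA; apply/forallP => i.
  by have := tW i; rewrite inE => /andP[].
have tPhi i : t i \in Phi by move: tbad; rewrite inE => /andP[/forallP].
have [/forallP dis|ndis] := boolP [forall i, forall j, (i != j) ==> ~~ meets (t i) (t j)]; last first.
  rewrite big1 ?exprn_ge0 // => A _; case: ifP => //; rewrite inE => /andP[_ dis].
  by rewrite dis in ndis.
have -> : (e * M)%N = #|\bigcup_i g (t i)|.
  rewrite -sum1_card partition_disjoint_bigcup.
    under eq_bigr => i _ do rewrite sum1_card card_g //.
    by rewrite sum_nat_const card_ord mulnC.
  by move=> i j ij; have /forallP/(_ j) := dis i; rewrite ij negbK.
rewrite -sum_prw_sup [leRHS]big_mkcond [leLHS]big_mkcond /=; apply: ler_sum => A _.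
have pA := prw_ge0 A; case: ifP => [_|_]; last by case: ifP.
case: ifP => [/free_tuplesP[tW _]|_]; last by case: ifP.
rewrite ifT //; apply/bigcupsP => i _; by have := tW i; rewrite inE => /andP[].
Qed.

(* [free_tuples] are counted in expectation on the bad event: edge-disjointness
   makes the probability that [A] contains a given tuple exactly [p ^ (e * M)],
   so no upper tail estimate for the number of copies is needed. *)
Lemma bad_prob : \sum_(A | bad A) prw A <=
  eta * (1 + M%:R) / eps ^+ 2 + (theta / (1 - 3 * eps)) ^+ M.
Proof.
have M0 : 0 < M%:R :> R by rewrite ltr0n.
pose k := eps ^+ 2 / M%:R.
have k0 : 0 < k by rewrite divr_gt0 ?exprn_gt0.
pose y := (1 - 3 * eps) * m.
have y0 : 0 < y by rewrite mulr_gt0 // subr_gt0.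
(* A bad [A] has few copies, or many meeting pairs, or at least [y ^+ M] free tuples; the last case
   is weighted for Markov's inequality. *)
apply: (@le_trans _ _ (\sum_A ((if #|copies_in A|%:R < (1 - eps) * m then prw A else 0) +
   (if k * m ^+ 2 < (meeting_pairs A)%:R then prw A else 0) +
   (if bad A then prw A * #|free_tuples meets M (copies_in A)|%:R / y ^+ M else 0)))).
  rewrite big_mkcond; apply: ler_sum => A _; have pA := prw_ge0 A.
  have pos : 0 <= prw A * #|free_tuples meets M (copies_in A)|%:R / y ^+ M.
    by apply: divr_ge0; [apply: mulr_ge0 | apply/exprn_ge0/ltW].
  case: ifP => bA; last first.
    by rewrite !addr_ge0 //; case: ifP.
  have [|many] := ltP; first by case: ifP => _ _; lra.
  have [|few] := ltP; first by lra.
  rewrite !add0r ler_pdivlMr ?exprn_gt0 // ler_wpM2l // many_free_tuples //.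
rewrite !big_split /= -!big_mkcond /= -mulr_suml.
have -> : eta * (1 + M%:R) / eps ^+ 2 = eta / eps ^+ 2 + eta / k.
  by rewrite /k; field; rewrite !gt_eqF.
rewrite !lerD ?few_copies_prob ?many_meeting_prob //.
rewrite ler_pdivrMr ?exprn_gt0 // -exprMn.
have -> : theta / (1 - 3 * eps) * y = theta * m.
  by rewrite /y; field; rewrite gt_eqF // subr_gt0.
exact: exp_bad_free_tuples.
Qed.

End BinomialRandomSet.

(** * Union bound over fingerprints *)

Lemma card_ffun_family (A B : finType) (F : A -> {set B}) :
  #|[set f : {ffun A -> B} | [forall i, f i \in F i]]| = (\prod_i #|F i|)%N.
Proof.
transitivity #|family (fun i => mem (F i))|.
  by apply: eq_card => f; rewrite inE; apply/forallP/familyP.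
by rewrite card_family foldrE big_map big_enum.
Qed.

Section HittingTuples.
Variables (R : realFieldType) (I V L : finType) (M b : nat) (c0 x : R).
Variables (Phi : {set I}) (lab : I -> L -> V -> bool) (cont : {set V} -> {set V}).
Hypotheses (c0_le1 : c0 <= 1) (x01 : 0 < x <= 1).

(* [lab f l v] says that the label [l] designates the vertex [v] in the copy [f];
   a marking ['I_M -> option L] then describes a fingerprint through the tuple. *)
Definition hitting (C : {set V}) : {set I} :=
  [set f in Phi | [exists v in C, exists l, lab f l v]].

Definition avoidable (C : {set V}) : bool := #|hitting C|%:R <= (1 - c0) * #|Phi|%:R.

Definition picked (a : {ffun 'I_M -> option L}) (t : {ffun 'I_M -> I}) : {set V} :=
  [set u | [exists i, if a i is Some l then lab (t i) l u else false]].

(** Marked coordinates are arbitrary copies and spell out the fingerprint; each unmarked one must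
    hit the resulting container, which loses a factor [1 - c0]. *)
Definition hit_by (a : {ffun 'I_M -> option L}) (t : {ffun 'I_M -> I}) : bool :=
  [forall i, (a i != None) ==> (t i \in Phi)] && [forall i, (a i == None) ==>
     (avoidable (cont (picked a t)) && (t i \in hitting (cont (picked a t))))].

(* The set [picked a t] depends only on the marked coordinates of [t]. *)
Lemma card_hit_by a : #|[set t | hit_by a t]|%:R <=
  \prod_i (if a i == None then (1 - c0) * #|Phi|%:R else #|Phi|%:R).
Proof.
have c1 : 0 <= 1 - c0 by rewrite subr_ge0.
set S := [set t | _]; have [->|/set0Pn[t0 t0S]] := eqVneq S set0.
  by rewrite cards0; apply: prodr_ge0 => i _; case: ifP => _; rewrite ?mulr_ge0.
(* [rho] resets the unmarked coordinates to those of a fixed [t0]. [F1] then bounds the values of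
   [rho], and [F2] the tuples over each value. *)
pose rho (t : {ffun 'I_M -> I}) := [ffun i => if a i == None then t0 i else t i].
pose F1 i := if a i == None then [set t0 i] else Phi.
pose F2 (u : {ffun 'I_M -> I}) i := if a i == None then
   (if avoidable (cont (picked a u)) then hitting (cont (picked a u)) else set0) else [set u i].
have picked_rho t : picked a (rho t) = picked a t.
  apply/setP => u; rewrite !inE; apply: eq_existsb => i; rewrite ffunE.
  by case: (a i).
have -> : #|S| = (\sum_(u : {ffun 'I_M -> I} | [forall i, u i \in F1 i]) #|[set t in S | rho t == u]|)%N.
  rewrite -sum1_card (partition_big rho (fun u : {ffun 'I_M -> I} => [forall i, u i \in F1 i])) /=.
    by apply: eq_bigr => u _; rewrite -sum1_card; apply: eq_bigl => t; rewrite !inE.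
  move=> t; rewrite inE => /andP[/forallP tPhi _]; apply/forallP => i.
  by rewrite ffunE /F1; have := tPhi i; case: eqP => //= _ _; rewrite inE.
rewrite natr_sum.
apply: (@le_trans _ _ (\sum_(u : {ffun 'I_M -> I} | [forall i, u i \in F1 i])
   \prod_i (if a i == None then (1 - c0) * #|Phi|%:R else 1))).
  apply: ler_sum => u _.
  apply: (@le_trans _ _ (\prod_i #|F2 u i|%:R)).
    rewrite -natr_prod -card_ffun_family ler_nat; apply/subset_leq_card/subsetP => t.
    rewrite !inE => /andP[/andP[_ /forallP tH] /eqP <-]; apply/forallP => i.
    rewrite /F2 picked_rho; have := tH i; case: eqP => [_ /= /andP[-> ->//]|/eqP/negbTE ai _].
    by rewrite inE ffunE ai.
  apply: ler_prod => i _; rewrite ler0n /= /F2; case: ifP => _; last by rewrite cards1.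
  by case: ifP => // _; rewrite cards0 mulr_ge0.
rewrite sumr_const -[leLHS]mulr_natl.
have -> : #|(fun u : {ffun 'I_M -> I} => [forall i, u i \in F1 i])| = (\prod_i #|F1 i|)%N.
  by rewrite -card_ffun_family; apply: eq_card => u; rewrite inE.
rewrite natr_prod -big_split /=; apply: ler_prod => i _; rewrite /F1.
by case: ifP => _; rewrite ?cards1 ?mul1r ?mulr1 lexx andbT ?mulr_ge0.
Qed.

Variable B : {set {ffun 'I_M -> I}}.
Hypothesis B_Phi : forall t, t \in B -> forall i, t i \in Phi.
Hypothesis B_covered : forall t, t \in B -> exists (v : 'I_M -> V) (l : 'I_M -> L),
  (forall i u, lab (t i) (l i) u = (u == v i)) /\
  exists S : {set V}, [/\ S \subset [set v i | i : 'I_M], (#|S| <= b)%N,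
    [set v i | i : 'I_M] \subset cont S & avoidable (cont S)].

Definition marked (a : {ffun 'I_M -> option L}) := #|[set i | a i != None]|.

(** Each fingerprint vertex is some [v i]. Marking one such index per vertex, with label [l i],
    gives at most [b] marks, and the vertices picked are exactly [S]. *)
Lemma exists_marking t : t \in B -> exists a, (marked a <= b)%N && hit_by a t.
Proof.
move=> tB; have [v [l [labE [S [Sv Sb vS av]]]]] := B_covered tB.
have ix u : u \in S -> exists i, u == v i.
  by move/(subsetP Sv)/imsetP => [i _ ->]; exists i.
pose T : {set 'I_M} := [set i | [exists u in S, [pick i | u == v i] == Some i]].
have TS : (#|T| <= #|S|)%N.
  have [u0 u0S|none] := pickP (mem S); last first.
    rewrite (_ : T = set0) ?cards0 //; apply/setP => i; rewrite !inE.
    by apply/existsP => -[u]; have /= -> := none u.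
  have [i0 _] := ix u0 u0S.
  pose h u := if [pick i | u == v i] is Some i then i else i0.
  apply: leq_trans (leq_imset_card h (mem S)); apply/subset_leq_card/subsetP => i.
  by rewrite inE => /existsP[u /andP[uS /eqP ui]]; apply/imsetP; exists u; rewrite // /h ui.
pose a : {ffun 'I_M -> option L} := [ffun i => if i \in T then Some (l i) else None].
have aE i : (a i != None) = (i \in T) by rewrite ffunE; case: ifP.
exists a; apply/andP; split.
  by apply: leq_trans (leq_trans TS Sb); apply/subset_leq_card/subsetP => i; rewrite inE aE.
have pickE : picked a t = S.
  apply/setP => u; rewrite inE; apply/existsP/idP => [[i]|uS].
    rewrite ffunE; case: ifP => // iT; rewrite labE => /eqP ->.
    move: iT; rewrite inE => /existsP[u' /andP[u'S]].
    by case: pickP => // j /eqP u'j /eqP[ij]; rewrite -ij -u'j.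
  have [i /eqP ui] := ix u uS.
  case E : [pick i | u == v i] => [j|]; last by move: E; case: pickP => // /(_ i); rewrite ui eqxx.
  have uj : u == v j by move: E; case: pickP => // j' uj' [<-].
  exists j; rewrite ffunE ifT; first by rewrite labE.
  by rewrite inE; apply/existsP; exists u; rewrite uS E /=.
rewrite /hit_by pickE av /=; apply/andP; split; apply/forallP => i; apply/implyP => _.
  exact: B_Phi.
rewrite inE B_Phi //=; apply/existsP; exists (v i); rewrite (subsetP vS) ?imset_f //=.
by apply/existsP; exists (l i); rewrite labE.
Qed.

(* A marking [a] with at most [b] marks has [x ^- b * x ^ (marked a) >= 1], and
   with these weights the sum over all markings factorises. *)
Lemma card_covered_tuples :
  #|B|%:R <= ((x^-1) ^+ b * (1 - c0 + #|L|%:R * x) ^+ M) * #|Phi|%:R ^+ M.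
Proof.
have c1 : 0 <= 1 - c0 by rewrite subr_ge0.
have [x0 x1] := andP x01.
apply: (@le_trans _ _ (\sum_a (if (marked a <= b)%N then #|[set t | hit_by a t]|%:R else 0))).
  rewrite -big_mkcond /= -natr_sum ler_nat.
  have BU : B \subset \bigcup_(a | (marked a <= b)%N) [set t | hit_by a t].
    apply/subsetP => t /exists_marking[a /andP[ab at_]].
    by apply/bigcupP; exists a => //; rewrite inE.
  apply: leq_trans (subset_leq_card BU) _.
  elim/big_rec2: _ => [|a m U _ IH]; first by rewrite cards0.
  by rewrite (leq_trans (leq_card_setU _ _)) // leq_add2l.
apply: (@le_trans _ _ (\sum_(a : {ffun 'I_M -> option L}) (x^-1) ^+ b *
   \prod_i (if a i == None then (1 - c0) * #|Phi|%:R else x * #|Phi|%:R))).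
  apply: ler_sum => a _.
  have -> : \prod_i (if a i == None then (1 - c0) * #|Phi|%:R else x * #|Phi|%:R) =
     x ^+ marked a * \prod_i (if a i == None then (1 - c0) * #|Phi|%:R else #|Phi|%:R).
    rewrite (bigID (fun i => a i == None)) /= [in RHS](bigID (fun i => a i == None)) /=.
    rewrite mulrCA; congr (_ * _).
      by apply: eq_bigr => i ->.
    rewrite -prodr_const [LHS]big_mkcond [X in _ = X * _]big_mkcond [X in _ = _ * X]big_mkcond -big_split /=.
    by apply: eq_bigr => i _; rewrite inE; case: eqP => //=; rewrite ?mulr1.
  case: ifP => [ab|_]; last first.
    rewrite !mulr_ge0 ?exprn_ge0 ?invr_ge0 ?(ltW x0) //.
    by apply: prodr_ge0 => i _; case: ifP => _; rewrite ?mulr_ge0.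
  rewrite mulrA -[leLHS]mul1r ler_pM ?card_hit_by //.
  rewrite exprVn ler_pdivlMl ?exprn_gt0 // mulr1.
  by apply: ler_wiXn2l => //; exact: ltW.
rewrite -mulr_sumr -mulrA ler_wpM2l ?exprn_ge0 ?invr_ge0 ?(ltW x0) //.
rewrite -(bigA_distr_bigA (fun (i : 'I_M) (o : option L) =>
  if o == None then (1 - c0) * #|Phi|%:R else x * #|Phi|%:R)).
rewrite prodr_const card_ord -exprMn le_eqVlt; apply/orP; left; apply/eqP; congr (_ ^+ _).
rewrite (bigD1 None) //= (eq_bigr (fun=> x * #|Phi|%:R)); last by move=> o /negbTE ->.
rewrite sumr_const cardC1 card_option /= -[_ *+ #|L|]mulr_natl; ring.
Qed.

End HittingTuples.

(** * Ramsey supersaturation *)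

Section HypergraphRamsey.
Local Open Scope nat_scope.
Variable K : finType.

Lemma exists_subset_card (T : finType) (A : {set T}) m : m <= #|A| ->
  exists2 B : {set T}, B \subset A & #|B| = m.
Proof.
elim: m => [|m IHm] mA; first by exists set0; rewrite ?sub0set ?cards0.
have [B BA Bm] := IHm (ltnW mA).
have /subsetPn[x xA xB] : ~~ (A \subset B).
  by apply: contraL mA => /subset_leq_card; rewrite Bm -leqNgt.
by exists (x |: B); rewrite ?subUset ?sub1set ?xA // cardsU1 xB Bm.
Qed.

Lemma card_bigcup_leq (T I : finType) (P : pred I) (F : I -> {set T}) :
  #|\bigcup_(i | P i) F i| <= \sum_(i | P i) #|F i|.
Proof.
elim/big_rec2: _ => [|i a U _ IH]; first by rewrite cards0.
by rewrite (leq_trans (leq_card_setU _ _)) // leq_add2l.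
Qed.

(** Induction on [r]. First a set is built in which the colour of an edge is a function [f] of one
    of its vertices, the one selected earliest ([prehom]); then the pigeonhole principle makes [f]
    constant. *)
Lemma hypergraph_ramsey r m : exists N, forall (T : finType) (W : {set T}) (c : {set T} -> K),
  N <= #|W| -> exists (A : {set T}) (k : K), [/\ A \subset W, #|A| = m &
    forall e : {set T}, e \subset A -> #|e| = r -> c e = k].
Proof.
elim: r m => [|r IHr] m.
  exists m => T W c /exists_subset_card[A AW Am]; exists A, (c set0); split=> // e _.
  by move/cards0_eq ->.
have prehom j : exists N, forall (T : finType) (W : {set T}) (c : {set T} -> K),
    N <= #|W| -> exists (A : {set T}) (f : T -> K), [/\ A \subset W, #|A| = j &
    forall e : {set T}, e \subset A -> #|e| = r.+1 -> exists2 x, x \in e & c e = f x].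
  elim: j => [|j [Nj IHj]].
    exists 0 => T W c _; exists set0, (fun=> c set0); split; rewrite ?sub0set ?cards0 //.
    by move=> e; rewrite subset0 => /eqP ->; rewrite cards0.
  have [N ramN] := IHr Nj; exists N.+1 => T W c NW.
  have /set0Pn[x xW] : W != set0 by rewrite -card_gt0 (leq_trans _ NW).
  have [|W' [k [W'W W'N homk]]] := ramN T (W :\ x) (fun e => c (x |: e)).
    by move: NW; rewrite (cardsD1 x) xW.
  (* All edges through [x] and inside [W'] already have colour [k], so the construction continues
     within [W']. *)
  have [|A [f [AW' Aj homf]]] := IHj T W' c; first by rewrite W'N.
  have xW' : x \notin W' by apply/negP => /(subsetP W'W); rewrite !inE eqxx.
  have xA : x \notin A by apply: contra xW'; exact: subsetP.
  exists (x |: A), (fun y => if y == x then k else f y); split.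
  - rewrite subUset sub1set xW (subset_trans AW') // (subset_trans W'W) //.
    exact: subsetDl.
  - by rewrite cardsU1 xA Aj.
  move=> e eA er; have [xe|xe] := boolP (x \in e).
    exists x; rewrite // eqxx -(setD1K xe) homk //; last by move: er; rewrite (cardsD1 x) xe => -[].
    by rewrite subDset (subset_trans eA) // setUS.
  have [|y ye ->] := homf e _ er; last by exists y; rewrite // ifN //; apply: contraNneq xe => <-.
  apply/subsetP => y ye; have := subsetP eA y ye; rewrite !inE => /orP[/eqP yx|//].
  by rewrite -yx ye in xe.
have [N preN] := prehom (#|K| * m).+1; exists N => T W c NW.
have [A [f [AW Am homf]]] := preN T W c NW.
have [k kA] : exists k, m <= #|[set x in A | f x == k]|.
  apply/existsP; apply: contraT => /existsPn small.
  have : #|A| <= #|K| * m.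
    rewrite -sum1_card (partition_big f predT) //= -sum_nat_const; apply: leq_sum => k _.
    by have := small k; rewrite -ltnNge => /ltnW; rewrite -sum1_card; under eq_bigl do rewrite inE.
  by rewrite Am ltnn.
have [B Bk Bm] := exists_subset_card kA; exists B, k; split=> //.
  by apply: subset_trans AW; apply/subsetP => x /(subsetP Bk); rewrite inE => /andP[].
have BA : B \subset A by apply/subsetP => x /(subsetP Bk); rewrite inE => /andP[].
move=> e eB er; have [x xe ->] := homf e (subset_trans eB BA) er.
by have := subsetP Bk x (subsetP eB x xe); rewrite inE => /andP[_ /eqP].
Qed.

Lemma card_ffun_restrict (A B : finType) (U : {set A}) (G : A -> {set B}) a :
  (forall x, x \in U -> #|G x| <= a) ->
  #|[set f : {ffun A -> B} | [forall x in U, f x \in G x]]| <= a ^ #|U| * #|B| ^ (#|A| - #|U|).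
Proof.
move=> Ga; apply: (@leq_trans (\prod_x #|if x \in U then G x else setT|)).
  rewrite -card_ffun_family; apply/subset_leq_card/subsetP => f.
  rewrite !inE => /forallP fG; apply/forallP => x.
  by have := fG x; case: (x \in U); rewrite ?inE.
rewrite (bigID (mem U)) /= leq_mul //.
  rewrite -prod_nat_const; apply: leq_prod => x xU; rewrite xU; exact: Ga.
rewrite (eq_bigr (fun=> #|B|)) => [|x /negbTE ->]; last by rewrite cardsT.
rewrite prod_nat_const -(cardsC U) addKn (eq_card (B := ~: U)) // => x.
by rewrite inE.
Qed.

(** Factor by factor, [n <= v * (n - i)] for [i < v <= n]. *)
Lemma expn_le_ffact n v : v <= n -> n ^ v <= v ^ v * n ^_ v.
Proof.
move=> vn; have nv k : k ^ v = \prod_(i < v) k by rewrite prod_nat_const card_ord.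
rewrite ffact_prod (nv n) (nv v) -big_split /=.
apply: leq_prod => i _; have := ltn_ord i; nia.
Qed.

End HypergraphRamsey.

(** * Labelled copies in the complete r-graph on [n] *)

Section Embeddings.
Variable r : nat.
Implicit Types F : hgraph r.

(** Copies are counted as injections of the vertex set, so that their number is a falling factorial;
    [eimg] is the edge set of such a copy. *)
Definition embs F n : {set {ffun vert F -> 'I_n}} :=
  [set f : {ffun vert F -> 'I_n} | injectiveb f].

Definition eimg F n (f : {ffun vert F -> 'I_n}) : {set rsubset r n} :=
  [set x | val x \in [set f @: (e : {set vert F}) | e in edges F]].

Lemma embsP {F n} {f : {ffun vert F -> 'I_n}} : reflect (injective f) (f \in embs F n).
Proof. by rewrite inE; exact: injectiveP. Qed.

Lemma eimgP {F n} {f : {ffun vert F -> 'I_n}} {x} :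
  reflect (exists2 e, e \in edges F & val x = f @: (e : {set vert F})) (x \in eimg f).
Proof. by rewrite inE; exact: imsetP. Qed.

Lemma edge_rsubset F n (f : {ffun vert F -> 'I_n}) (e : {set vert F}) : f \in embs F n -> e \in edges F ->
  exists2 x : rsubset r n, val x = f @: e & x \in eimg f.
Proof.
move=> /embsP finj eF.
have fe : #|f @: e| == r by rewrite card_imset // (edges_uniform eF).
by exists (Sub (f @: e) fe) => //; apply/eimgP; exists e.
Qed.

Lemma card_eimg F n (f : {ffun vert F -> 'I_n}) : f \in embs F n -> #|eimg f| = #|edges F|.
Proof.
move=> fF; have finj := embsP fF.
rewrite -(card_imset (mem (edges F)) (imset_inj finj)) -(card_imset _ val_inj).
apply: eq_card => y; apply/imsetP/imsetP => [[x /eimgP[e eF ->] ->]|[e eF ->]]; first by exists e.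
by have [x xe xf] := edge_rsubset fF eF; exists x.
Qed.

Lemma card_embs F n : #|embs F n| = (n ^_ #|vert F|)%N.
Proof.
have := card_inj_ffuns (vert F) 'I_n; rewrite card_ord => <-.
by apply: eq_card => f; rewrite !inE.
Qed.

Lemma expn_le_card_embs F n : (#|vert F| <= n)%N ->
  (n ^ #|vert F| <= #|vert F| ^ #|vert F| * #|embs F n|)%N.
Proof. by move=> vn; rewrite card_embs expn_le_ffact. Qed.

Lemma card_comp_in F N n (psi : {ffun vert F -> 'I_N}) (X : {set {ffun vert F -> 'I_n}}) :
  injective psi ->
  (#|[set i : {ffun 'I_N -> 'I_n} | [ffun v => i (psi v)] \in X]|
     <= #|X| * n ^ (N - #|vert F|))%N.
Proof.
move=> psi_inj; rewrite -sum1_card.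
rewrite (partition_big (fun i : {ffun 'I_N -> 'I_n} => [ffun v => i (psi v)]) (mem X)) /=; last first.
  by move=> i; rewrite inE.
rewrite -sum_nat_const; apply: leq_sum => f _; rewrite sum1_card.
pose U : {set 'I_N} := psi @: [set: vert F].
have UF : #|U| = #|vert F| by rewrite card_imset // cardsT.
pose G (x : 'I_N) : {set 'I_n} := [set y | [forall v, (psi v == x) ==> (y == f v)]].
apply: (@leq_trans #|[set i : {ffun 'I_N -> 'I_n} | [forall x in U, i x \in G x]]|).
  apply/subset_leq_card/subsetP => i; rewrite unfold_in /= => /andP[_ /eqP fi].
  rewrite inE; apply/forallP => x; apply/implyP => _; rewrite inE; apply/forallP => v.
  by apply/implyP => /eqP <-; rewrite -fi ffunE.
have := @card_ffun_restrict _ _ U G 1; rewrite exp1n mul1n card_ord card_ord UF; apply.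
move=> _ /imsetP[v _ ->]; apply/card_le1P => y.
rewrite inE => /forallP/(_ v); rewrite eqxx => /eqP -> z; rewrite inE; apply/forallP/eqP.
  by move=> /(_ v); rewrite eqxx => /eqP.
by move=> -> w; apply/implyP => /eqP/psi_inj ->.
Qed.

Lemma exists_emb F N (A : {set 'I_N}) : (#|vert F| <= #|A|)%N ->
  exists2 psi : {ffun vert F -> 'I_N}, injective psi & forall v, psi v \in A.
Proof.
move=> FA; exists [ffun v => enum_val (widen_ord FA (enum_rank v))].
  move=> v w; rewrite !ffunE => /enum_val_inj/(congr1 val)/= /val_inj.
  exact: enum_rank_inj.
by move=> v; rewrite ffunE enum_valP.
Qed.

(* Every injection of a Ramsey number of points into [n] contains a clique
   whose edges lie in one colour of [C], or all outside [C]; average. *)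
Lemma ramsey_supersaturation (R : realFieldType) (t : nat) (Q : 'I_t -> hgraph r)
    (J : pred 'I_t) (T : hgraph r) :
  exists c0 eps : R, [/\ 0 < c0, c0 <= 1, 0 < eps & exists n0, forall n, (n0 <= n)%N ->
  forall C : {set rsubset r n * 'I_t},
    (forall j, J j ->
      #|[set f in embs (Q j) n | [forall x in eimg f, (x, j) \in C]]|%:R
        <= eps * n%:R ^+ #|vert (Q j)|) ->
    c0 * n%:R ^+ #|vert T| <=
      #|[set f in embs T n | [forall x in eimg f, forall j, J j ==> ((x, j) \notin C)]]|%:R :> R].
Proof.
(* A homogeneous set of this size has room for [T] and for each [Q j]. *)
pose m := (#|vert T| + \sum_j #|vert (Q j)|)%N.
have [N ramN] := hypergraph_ramsey (option 'I_t) r m.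
pose S : R := 1 + \sum_(j < t) N%:R ^+ #|vert (Q j)|.
have S0 : 0 < S by rewrite ltr_wpDr ?sumr_ge0 // => j _; rewrite exprn_ge0.
(* [b] bounds from below the proportion of injections among the maps from [N] to [n]. The choice of
   [eps] lets copies of the [Q j] account for at most [b / 2], leaving the rest to copies of [T]. *)
pose b : R := (N%:R ^+ N)^-1.
have NN : 0 < N%:R ^+ N :> R.
  by rewrite -natrX ltr0n expn_gt0; case: (N).
have b0 : 0 < b by rewrite invr_gt0.
pose c0 : R := b / 2 / (1 + N%:R ^+ #|vert T|).
have NT : 0 < 1 + N%:R ^+ #|vert T| :> R by rewrite ltr_wpDr // exprn_ge0.
exists c0, (b / 2 / S); split.
- by rewrite !divr_gt0.
- rewrite ler_pdivrMr // mul1r (@le_trans _ _ 1) ?lerDl ?exprn_ge0 //.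
  have : b <= 1 by rewrite invf_le1 // -natrX ler1n expn_gt0; case: (N).
  lra.
- by rewrite !divr_gt0.
exists N.+1 => n Nn C few.
have n0 : 0 < n%:R :> R by rewrite ltr0n (leq_trans _ Nn).
pose Bad j := [set f in embs (Q j) n | [forall x in eimg f, (x, j) \in C]].
pose Good := [set f in embs T n | [forall x in eimg f, forall j, J j ==> ((x, j) \notin C)]].
rewrite -[X in _ <= X%:R]/#|Good|.
pose pull F (X : {set {ffun vert F -> 'I_n}}) (psi : {ffun vert F -> 'I_N}) :=
  [set i : {ffun 'I_N -> 'I_n} | [ffun v => i (psi v)] \in X].
have cover : [set i : {ffun 'I_N -> 'I_n} | injectiveb i] \subset
    (\bigcup_(j | J j) \bigcup_(psi in embs (Q j) N) pull _ (Bad j) psi) :|: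
    \bigcup_(psi in embs T N) pull _ Good psi.
  apply/subsetP => i; rewrite inE => /injectiveP i_inj.
  pose col (e : {set 'I_N}) : option 'I_t := [pick j | J j && [exists x : rsubset r n,
    (val x == i @: e) && ((x, j) \in C)]].
  have [|A [k [_ Am hom]]] := ramN _ [set: 'I_N] col; first by rewrite cardsT card_ord.
  have comp_emb F (psi : {ffun vert F -> 'I_N}) : injective psi ->
      [ffun v => i (psi v)] \in embs F n.
    by move=> psi_inj; apply/embsP => v w; rewrite !ffunE => /i_inj/psi_inj.
  have comp_img F (psi : {ffun vert F -> 'I_N}) (e : {set vert F}) :
      [ffun v => i (psi v)] @: e = i @: (psi @: e).
    by rewrite -imset_comp; apply: eq_imset => v; rewrite ffunE.
  have colE F (psi : {ffun vert F -> 'I_N}) e : injective psi -> (forall v, psi v \in A) ->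
      e \in edges F -> col (psi @: e) = k.
    move=> psi_inj psiA eF; apply: hom; last by rewrite card_imset // (edges_uniform eF).
    by apply/subsetP => _ /imsetP[v _ ->].
  have QA j : (#|vert (Q j)| <= #|A|)%N.
    by rewrite Am /m (bigD1 j) //= addnCA leq_addr.
  have TA : (#|vert T| <= #|A|)%N by rewrite Am leq_addr.
  (* If the common colour is [Some j], a copy of [Q j] placed in [A] lies in [C] with colour [j];
     otherwise a copy of [T] placed in [A] avoids [C] in every colour of [J]. *)
  have [[j Jj kj]|noJ] := pselect (exists2 j, J j & k = Some j).
    have [psi psi_inj psiA] := exists_emb (QA j).
    apply/setUP; left; apply/bigcupP; exists j => //; apply/bigcupP; exists psi; first exact/embsP.
    rewrite /pull in_set /Bad in_set comp_emb //=; apply/forall_inP => x /eimgP[e eF xe].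
    have := colE _ psi e psi_inj psiA eF; rewrite kj /col.
    case: pickP => // j' /andP[_ /existsP[x' /andP[/eqP x'e x'C]]] [jj'].
    by rewrite -jj' (_ : x = x') //; apply: val_inj; rewrite xe x'e comp_img.
  have [psi psi_inj psiA] := exists_emb TA.
  apply/setUP; right; apply/bigcupP; exists psi; first exact/embsP.
  rewrite /pull in_set /Good in_set comp_emb //=; apply/forall_inP => x /eimgP[e eF xe].
  apply/forall_inP => j Jj; apply/negP => xC.
  have := colE _ psi e psi_inj psiA eF; rewrite /col; case: pickP => [j' /andP[Jj' _] jk|].
    by apply: noJ; exists j'.
  move=> /(_ j); rewrite Jj /= => /existsP[]; exists x.
  by rewrite xC andbT xe comp_img.
have pull_card F (X : {set {ffun vert F -> 'I_n}}) :
    #|\bigcup_(psi in embs F N) pull F X psi|%:R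
      <= N%:R ^+ #|vert F| * (#|X|%:R / n%:R ^+ #|vert F|) * n%:R ^+ N :> R.
  have [/eqP N0|/set0Pn[psi0 /embsP psi0_inj]] := boolP (embs F N == set0).
    by rewrite N0 big_set0 cards0 !mulr_ge0 ?invr_ge0 ?exprn_ge0.
  have vN : (#|vert F| <= N)%N by have := leq_card psi0 psi0_inj; rewrite card_ord.
  apply: (@le_trans _ _ (\sum_(psi in embs F N) (#|X| * n ^ (N - #|vert F|)))%:R).
    rewrite ler_nat; apply: (@leq_trans (\sum_(psi in embs F N) #|pull F X psi|)).
      exact: card_bigcup_leq.
    by apply: leq_sum => psi /embsP; exact: card_comp_in.
  rewrite sum_nat_const natrM -!mulrA ler_pM //.
    have := card_ffun (vert F) 'I_N; rewrite card_ord => NF.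
    by rewrite -natrX ler_nat -NF max_card.
  rewrite natrM natrX ler_wpM2l // -(subnK vN) exprD subnK // mulrCA mulVf ?mulr1 //.
  by rewrite expf_neq0 // gt_eqF.
have nN : 0 < n%:R ^+ N :> R by rewrite exprn_gt0.
pose gd : R := #|Good|%:R / n%:R ^+ #|vert T|.
rewrite -ler_pdivlMr ?exprn_gt0 // -/gd.
have gd0 : 0 <= gd by rewrite divr_ge0 ?exprn_ge0.
suff main : b <= b / 2 + N%:R ^+ #|vert T| * gd by rewrite ler_pdivrMr //; lra.
rewrite -(ler_pM2r nN) mulrDl.
apply: (@le_trans _ _ #|[set i : {ffun 'I_N -> 'I_n} | injectiveb i]|%:R).
  rewrite ler_pdivrMl // card_inj_ffuns !card_ord -!natrX -natrM ler_nat.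
  by rewrite expn_le_ffact // ltnW.
move: (subset_leq_card cover); rewrite -(ler_nat R) => /le_trans; apply.
apply: (@le_trans _ _ (#|\bigcup_(j | J j) \bigcup_(psi in embs (Q j) N) pull _ (Bad j) psi|%:R
   + #|\bigcup_(psi in embs T N) pull _ Good psi|%:R)).
  by rewrite -natrD ler_nat leq_card_setU.
apply: lerD (pull_card _ _).
apply: (@le_trans _ _ (\sum_(j | J j)
   #|\bigcup_(psi in embs (Q j) N) pull _ (Bad j) psi|%:R)).
  by rewrite -natr_sum ler_nat card_bigcup_leq.
have bS : b / 2 = b / 2 / S * S by rewrite mulfVK // gt_eqF.
apply: (@le_trans _ _ (\sum_(j < t) (b / 2 / S * N%:R ^+ #|vert (Q j)|) * n%:R ^+ N)).
  rewrite big_mkcond; apply: ler_sum => j _.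
  have pos : 0 <= b / 2 / S * N%:R ^+ #|vert (Q j)| by rewrite !mulr_ge0 ?invr_ge0 ?exprn_ge0 // ltW.
  case: ifP => [Jj|_]; last by rewrite mulr_ge0 // ltW.
  apply: le_trans (pull_card _ _) _; rewrite ler_pM2r // mulrC ler_wpM2r ?exprn_ge0 //.
  by rewrite ler_pdivrMr ?exprn_gt0 // few.
rewrite -mulr_suml -mulr_sumr ler_pM2r // [leRHS]bS ler_wpM2l ?lerDr //.
by rewrite !mulr_ge0 ?invr_ge0 // ltW.
Qed.

End Embeddings.

(** * Copies in the random hypergraph *)

(* [n ^ |cover S| * p ^ |S|] is, up to constants, the expected number of copies
   in the random [r]-graph of the subhypergraph of [F] spanned by [S]. *)
Definition rich (R : realFieldType) r (F : hgraph r) (n : nat) (p om : R) :=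
  forall S : {set {set vert F}}, S \subset edges F -> S != set0 ->
    om <= n%:R ^+ #|cover S| * p ^+ #|S|.

Section CountingCopies.
Variables (r : nat) (F : hgraph r) (n : nat).
Local Notation v := #|vert F|.

(** The edges of [F] mapped onto [J0] form a set [J] with [#|J| = #|J0|], and [f] sends [cover J]
    onto the union [L] of [J0]. This leaves at most [v ^ v] choices on [cover J], and [n] for each
    other vertex. *)
Lemma card_embs_containing (J0 : {set rsubset r n}) :
  (#|[set f in embs F n | J0 \subset eimg f]| <=
   \sum_(J : {set {set vert F}} | (J \subset edges F) && (#|J| == #|J0|))
      v ^ v * n ^ (v - #|cover J|))%N.
Proof.
pose L : {set 'I_n} := \bigcup_(x in J0) val x.
pose P J (f : {ffun vert F -> 'I_n}) := (#|L| <= #|cover J|)%N && [forall u in cover J, f u \in L].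
have sub : [set f in embs F n | J0 \subset eimg f] \subset
    \bigcup_(J : {set {set vert F}} | (J \subset edges F) && (#|J| == #|J0|)) [set f | P J f].
  apply/subsetP => f; rewrite inE => /andP[/embsP f_inj /subsetP J0f].
  pose J := [set e in edges F | [exists x in J0, val x == f @: (e : {set vert F})]].
  have J_im : [set f @: (e : {set vert F}) | e in J] = val @: J0.
    apply/setP => y; apply/imsetP/imsetP => [[e]|[x xJ0 ->]].
      by rewrite inE => /andP[_ /existsP[x /andP[xJ0 /eqP xe]]] ->; exists x.
    have /eimgP[e eF xe] := J0f x xJ0; exists e => //.
    by rewrite inE eF; apply/existsP; exists x; rewrite xJ0 xe /=.
  have Lf : L = f @: cover J.
    rewrite /cover; apply/setP => y; apply/bigcupP/imsetP => [[x xJ0 yx]|[u /bigcupP[e eJ ue] ->]].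
      have : val x \in val @: J0 by apply: imset_f.
      rewrite -J_im => /imsetP[e eJ xe]; move: yx; rewrite xe => /imsetP[u ue ->].
      by exists u => //; apply/bigcupP; exists e.
    have : f @: e \in val @: J0 by rewrite -J_im imset_f.
    by move=> /imsetP[x xJ0 fe]; exists x => //; rewrite -fe imset_f.
  apply/bigcupP; exists J.
    apply/andP; split; first by apply/subsetP => e; rewrite inE => /andP[].
    by rewrite -(card_imset (mem J) (imset_inj f_inj)) J_im card_imset //; exact: val_inj.
  rewrite inE /P Lf leq_imset_card; apply/forall_inP => u uJ; exact: imset_f.
apply: leq_trans (subset_leq_card sub) _; apply: leq_trans (card_bigcup_leq _ _) _.
apply: leq_sum => J _; rewrite /P.
have [Lc|_] := leqP #|L| #|cover J|; last first.
  by rewrite (_ : [set f | _] = set0) ?cards0 //; apply/setP => f; rewrite !inE.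
have := @card_ffun_restrict _ _ (cover J) (fun=> L) _ (fun _ _ => Lc).
rewrite card_ord => /leq_trans; apply; apply: leq_mul => //.
have cv : (#|cover J| <= v)%N by exact: max_card.
have [->|c0] := posnP #|cover J|; first by rewrite expn0 expn_gt0; case: (v).
rewrite (@leq_trans (v ^ #|cover J|)) ?leq_exp2r // leq_pexp2l // (leq_trans c0) //.
Qed.

(** The factors count the shared edge set, the map [k] identifying vertices of the two copies, and
    the loss from [n ^ v] to the number of embeddings. *)
Definition pair_const : nat := 2 ^ #|edges F| * v ^ v * v ^ v.

(** If [f] and [h] share the images of a nonempty edge set [J], then [f = h \o k] on [cover J] for
    some [k]. Given [h], [J] and [k] there are at most [n ^ (v - #|cover J|)] such [f], the union
    has [2 * e - #|J|] edges, and richness bounds the product. *)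
Lemma mean_meeting_embs (R : realFieldType) (p Z : R) : 0 < p <= 1 -> 0 < Z ->
  (v <= n)%N ->
  rich F n p Z ->
  mean_meeting p (embs F n) (@eimg r F n) <=
    pair_const%:R / Z * mean_copies p (embs F n) #|edges F| ^+ 2.
Proof.
move=> p01 Z0 vn Zle; have p0 : 0 < p by case/andP: p01.
pose e := #|edges F|.
pose agree (J : {set {set vert F}}) (k : {ffun vert F -> vert F}) (f h : {ffun vert F -> 'I_n}) :=
  [forall u in cover J, f u == h (k u)].
have pointwise f h : f \in embs F n -> h \in embs F n -> meets (@eimg r F n) f h ->
    p ^+ #|eimg f :|: eimg h| <=
    \sum_(J : {set {set vert F}} | (J \subset edges F) && (J != set0)) \sum_(k : {ffun vert F -> vert F})
       (if agree J k f h then p ^+ (2 * e - #|J|) else 0).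
  move=> fF hF fh; have f_inj := embsP fF.
  pose J := [set a in edges F | [exists b in edges F, f @: (a : {set vert F}) == h @: (b : {set vert F})]].
  have J_sub : J \subset edges F by apply/subsetP => a; rewrite inE => /andP[].
  have J_im : [set f @: (a : {set vert F}) | a in J] = val @: (eimg f :&: eimg h).
    apply/setP => y; apply/imsetP/imsetP => [[a]|[x]].
      rewrite inE => /andP[aF /existsP[b /andP[bF /eqP ab]]] ->.
      have [x xa xf] := edge_rsubset fF aF; exists x => //; rewrite inE xf /=.
      by apply/eimgP; exists b; rewrite // xa.
    rewrite inE => /andP[/eimgP[a aF xa] /eimgP[b bF xb]] ->; exists a => //.
    by rewrite inE aF; apply/existsP; exists b; rewrite bF -xa -xb /=.
  have J_card : #|J| = #|eimg f :&: eimg h|.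
    by rewrite -(card_imset (mem J) (imset_inj f_inj)) J_im card_imset //; exact: val_inj.
  have J0 : J != set0.
    rewrite -card_gt0 J_card card_gt0; by move: fh; rewrite /meets -setI_eq0.
  pose k : {ffun vert F -> vert F} := [ffun u => odflt u [pick w | f u == h w]].
  have kJ : agree J k f h.
    apply/forall_inP => u /bigcupP[a]; rewrite inE => /andP[_ /existsP[b /andP[_ /eqP ab]]] ua.
    have : f u \in h @: b by rewrite -ab imset_f.
    case/imsetP => w _ fu; rewrite ffunE; case: pickP => [//|/(_ w)].
    by rewrite fu eqxx.
  rewrite (bigD1 J) /=; last by rewrite J_sub.
  rewrite (bigD1 k) //= kJ cardsU !card_eimg // -/e addnn -mul2n -J_card -addrA lerDl addr_ge0 //.
    by apply: sumr_ge0 => k' _; case: ifP => // _; rewrite exprn_ge0 // ltW.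
  by apply: sumr_ge0 => J' _; apply: sumr_ge0 => k' _; case: ifP => // _; rewrite exprn_ge0 // ltW.
apply: (@le_trans _ _ (\sum_(J : {set {set vert F}} | (J \subset edges F) && (J != set0))
   \sum_(k : {ffun vert F -> vert F}) \sum_(h in embs F n) \sum_(f in embs F n)
       (if agree J k f h then p ^+ (2 * e - #|J|) else 0))).
  rewrite /mean_meeting.
  apply: (@le_trans _ _ (\sum_(f in embs F n) \sum_(h in embs F n)
    \sum_(J : {set {set vert F}} | (J \subset edges F) && (J != set0)) \sum_(k : {ffun vert F -> vert F})
       (if agree J k f h then p ^+ (2 * e - #|J|) else 0))).
    apply: ler_sum => f fF; rewrite big_mkcondr; apply: ler_sum => h hF.
    case: ifP => [fh|_]; first exact: pointwise.
    by apply: sumr_ge0 => J' _; apply: sumr_ge0 => k' _; case: ifP => // _; rewrite exprn_ge0 // ltW.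
  rewrite exchange_big /=.
  under eq_bigr => h _.
    rewrite exchange_big /=.
    under eq_bigr => J _ do rewrite exchange_big /=.
    over.
  rewrite exchange_big /=; apply: ler_sum => J _.
  by rewrite exchange_big.
pose m := mean_copies p (embs F n) e.
have n0 : 0 < n%:R :> R \/ v = 0%N.
  by case: (posnP n) => [n0|n0]; [right; apply/eqP; rewrite -leqn0 -n0 | left; rewrite ltr0n].
have step (J : {set {set vert F}}) (k : {ffun vert F -> vert F}) (h : {ffun vert F -> 'I_n}) :
    J \subset edges F -> J != set0 ->
    \sum_(f in embs F n) (if agree J k f h then p ^+ (2 * e - #|J|) else 0) <=
    (v ^ v)%:R * #|embs F n|%:R / Z * p ^+ e * p ^+ e.
  move=> JF J0; rewrite -big_mkcondr sumr_const -[leLHS]mulr_natr /=.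
  have cv : (#|cover J| <= v)%N by exact: max_card.
  have Je : (#|J| <= 2 * e)%N by rewrite (leq_trans (subset_leq_card JF)) // leq_pmull.
  have count : (#|[pred f in embs F n | agree J k f h]| <= n ^ (v - #|cover J|))%N.
    have := @card_ffun_restrict _ _ (cover J) (fun u => [set h (k u)]) 1 (fun u _ => eq_leq (cards1 _)).
    rewrite exp1n mul1n card_ord => /(leq_trans _); apply.
    apply/subset_leq_card/subsetP => f; rewrite !inE => /andP[_ /forall_inP fh].
    by apply/forall_inP => u /fh; rewrite inE.
  have pos : 0 < n%:R ^+ #|cover J| :> R.
    have : 0 < n%:R ^+ #|cover J| * p ^+ #|J| by apply: lt_le_trans Z0 (Zle J JF J0).
    by rewrite pmulr_lgt0 // exprn_gt0.
  apply: (@le_trans _ _ (p ^+ (2 * e - #|J|) * n%:R ^+ (v - #|cover J|))).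
    by rewrite ler_pM2l ?exprn_gt0 // -natrX ler_nat.
  have -> : p ^+ (2 * e - #|J|) * n%:R ^+ (v - #|cover J|) =
      n%:R ^+ v * (p ^+ e * p ^+ e) / (n%:R ^+ #|cover J| * p ^+ #|J|).
    have pJ : p ^+ #|J| != 0 by rewrite expf_neq0 // gt_eqF.
    have nc : n%:R ^+ #|cover J| != 0 :> R by rewrite gt_eqF.
    have -> : n%:R ^+ v = n%:R ^+ (v - #|cover J|) * n%:R ^+ #|cover J| :> R.
      by rewrite -exprD subnK.
    have -> : p ^+ e * p ^+ e = p ^+ (2 * e - #|J|) * p ^+ #|J|.
      by rewrite -!exprD subnK // addnn mul2n.
    move: (n%:R ^+ (v - _)) (n%:R ^+ #|cover J|) (p ^+ (_ - _)) (p ^+ #|J|) nc pJ => a b c d b0 d0.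
    by field; rewrite b0 d0.
  apply: (@le_trans _ _ (n%:R ^+ v * (p ^+ e * p ^+ e) / Z)).
    rewrite ler_wpM2l ?mulr_ge0 ?exprn_ge0 // ?(ltW p0) //.
    by rewrite lef_pV2 ?posrE ?Zle // mulr_gt0 // exprn_gt0.
  rewrite -[leRHS]mulrA [leRHS]mulrAC ler_wpM2r ?invr_ge0 ?(ltW Z0) //.
  rewrite ler_wpM2r ?mulr_ge0 ?exprn_ge0 ?(ltW p0) //.
  by rewrite -natrM -natrX ler_nat expn_le_card_embs.
apply: (@le_trans _ _ (\sum_(J : {set {set vert F}} | (J \subset edges F) && (J != set0))
   \sum_(k : {ffun vert F -> vert F}) \sum_(h in embs F n)
      (v ^ v)%:R * #|embs F n|%:R / Z * p ^+ e * p ^+ e)).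
  apply: ler_sum => J /andP[JF J0]; apply: ler_sum => k _; apply: ler_sum => h _; exact: step.
rewrite sumr_const -[leLHS]mulr_natl.
have pos : 0 <= \sum_(k : {ffun vert F -> vert F}) \sum_(h in embs F n)
      (v ^ v)%:R * #|embs F n|%:R / Z * p ^+ e * p ^+ e.
  by do 2![apply: sumr_ge0 => ? _]; rewrite !mulr_ge0 ?exprn_ge0 ?invr_ge0 ?(ltW p0) ?(ltW Z0).
apply: (@le_trans _ _ ((2 ^ e)%:R * \sum_(k : {ffun vert F -> vert F}) \sum_(h in embs F n)
      (v ^ v)%:R * #|embs F n|%:R / Z * p ^+ e * p ^+ e)).
  rewrite ler_wpM2r // ler_nat -card_powerset; apply/subset_leq_card/subsetP => J.
  by rewrite unfold_in inE => /andP[].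
rewrite !sumr_const card_ffun -[_ *+ #|embs F n|]mulr_natl -[_ *+ (v ^ v)]mulr_natl.
rewrite le_eqVlt; apply/orP; left; apply/eqP.
rewrite /mean_copies /pair_const -/e !natrM.
by move: (p ^+ e) => pe; move: (2 ^ e)%N (v ^ v)%N => a b; field; rewrite gt_eqF.
Qed.

End CountingCopies.

(** * Containers for edge sets in several colours *)

Section ColouredCopies.
Variables (R : archiRealFieldType) (r t : nat) (Q : 'I_t -> hgraph r) (J : pred 'I_t).
Local Notation slot n := (rsubset r n * 'I_t)%type.

(** The container hypergraph has the pairs (edge, colour) as vertices, so one set records the edges
    of all colours in [J] at once. *)
Definition cimg F n (f : {ffun vert F -> 'I_n}) (j : 'I_t) : {set slot n} :=
  [set (x, j) | x in @eimg r F n f].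

(** Dividing by [n ^ #|vert (Q j)|] puts the copies of the different [Q j] on a common scale: weight
    at most [eps] means a small proportion of copies for every [j]. *)
Definition copy_weight n (E : {set slot n}) : R :=
  \sum_(j < t | J j) \sum_(f in embs (Q j) n)
     (if cimg f j == E then (n%:R ^+ #|vert (Q j)|)^-1 else 0).

Lemma copy_weight_ge0 n E : 0 <= @copy_weight n E.
Proof.
by apply: sumr_ge0 => j _; apply: sumr_ge0 => f _; case: ifP => // _; rewrite invr_ge0 exprn_ge0.
Qed.

Lemma sum_copy_weight n (P : pred {set slot n}) :
  \sum_(E | P E) copy_weight E = \sum_(j < t | J j) \sum_(f in embs (Q j) n)
     (if P (cimg f j) then (n%:R ^+ #|vert (Q j)|)^-1 else 0).
Proof.
rewrite exchange_big; apply: eq_bigr => j _; rewrite exchange_big; apply: eq_bigr => f _.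
rewrite big_mkcond /= (bigD1 (cimg f j)) //= eqxx big1 ?addr0 // => E.
by rewrite eq_sym => /negbTE ->; case: ifP.
Qed.

Lemma copy_weight_gt0 n (E : {set slot n}) : 0 < copy_weight E ->
  exists j, J j /\ exists2 f, f \in embs (Q j) n & E = cimg f j.
Proof.
move=> wE; apply: contrapT => none; move: wE; rewrite /copy_weight big1 ?ltxx // => j Jj.
rewrite big1 // => f fQ; case: eqP => // fE; case: none.
by exists j; split=> //; exists f.
Qed.

Lemma card_cimg F n (f : {ffun vert F -> 'I_n}) j : f \in embs F n ->
  #|cimg f j| = #|edges F|.
Proof. by move=> fF; rewrite card_imset ?card_eimg // => x y []. Qed.

Lemma card_slot n : (#|{: slot n}| <= t * n ^ r)%N.
Proof.
rewrite card_prod card_ord mulnC leq_mul2l; apply/orP; right.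
rewrite card_sig -[X in (X <= _)%N]cardsE card_draws card_ord.
apply: (@leq_trans (n ^_ r)); first by rewrite -bin_ffact leq_pmulr // fact_gt0.
have -> : (n ^ r = \prod_(i < r) n)%N by rewrite prod_nat_const card_ord.
by rewrite ffact_prod; apply: leq_prod => i _; exact: leq_subr.
Qed.

(** The term [t] bounds the number of slots over [n ^ r], the 1 makes the constant at least 1, and
    the sum comes from the degree bounds of the [Q j]. *)
Definition spread_const : R :=
  t%:R + 1 + \sum_(j < t) (2 ^ #|edges (Q j)| * #|vert (Q j)| ^ #|vert (Q j)|)%:R.

(** A [J0] inside a copy of colour [j] is determined by its underlying edges, so
    [card_embs_containing] applies; richness turns each [n ^- #|cover S|] into at most
    [q ^+ #|J0| / D]. *)
Lemma copy_weight_spread n (q D : R) : (0 < n)%N -> 0 < q -> 0 < D ->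
  (forall j, J j -> rich (Q j) n q D) ->
  spread spread_const D q (@copy_weight n).
Proof.
move=> n0 q0 D0 Dle J0 J00; rewrite /wdeg sum_copy_weight.
have nR : 0 < n%:R :> R by rewrite ltr0n.
have qD : 0 <= q ^+ #|J0| / D by rewrite divr_ge0 ?exprn_ge0 // ltW.
apply: (@le_trans _ _ (\sum_(j < t)
   (2 ^ #|edges (Q j)| * #|vert (Q j)| ^ #|vert (Q j)|)%:R * (q ^+ #|J0| / D))); last first.
  rewrite -mulr_suml mulrAC -mulrA ler_wpM2r // /spread_const lerDr.
  by rewrite addr_ge0.
rewrite big_mkcond; apply: ler_sum => j _; case: ifP => Jj; last by rewrite mulr_ge0.
rewrite -big_mkcondr sumr_const -[leLHS]mulr_natl /=.
set v := #|vert (Q j)|; set N := #|_|.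
have [->|] := posnP N; first by rewrite mul0r mulr_ge0.
rewrite lt0n => /pred0Pn[f0 /= /andP[_ J0f0]].
pose J1 : {set rsubset r n} := fst @: J0.
have J0E u : u \in J0 -> u = (u.1, j).
  by move/(subsetP J0f0)/imsetP => [x _ ->].
have J1c : #|J1| = #|J0|.
  by rewrite card_in_imset // => u w uJ wJ uw; rewrite (J0E u uJ) (J0E w wJ) uw.
have NJ1 : (N <= #|[set f in embs (Q j) n | J1 \subset eimg f]|)%N.
  apply/subset_leq_card/subsetP => f; case/andP=> fQ /subsetP J0f; rewrite in_set fQ /=.
  by apply/subsetP => _ /imsetP[u /J0f/imsetP[x xf ->] ->].
have := leq_trans NJ1 (card_embs_containing (Q j) J1); rewrite J1c => NS.
apply: (@le_trans _ _ (\sum_(S : {set {set vert (Q j)}} | (S \subset edges (Q j)) && (#|S| == #|J0|))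
    (v ^ v)%:R * (q ^+ #|J0| / D))).
  apply: (@le_trans _ _ ((\sum_(S : {set {set vert (Q j)}} | (S \subset edges (Q j)) && (#|S| == #|J0|))
    v ^ v * n ^ (v - #|cover S|))%:R / n%:R ^+ v)).
    by rewrite ler_wpM2r ?invr_ge0 ?exprn_ge0 // ler_nat.
  rewrite natr_sum mulr_suml; apply: ler_sum => S /andP[SQ /eqP SJ0].
  rewrite natrM -mulrA ler_wpM2l // natrX.
  have S0 : S != set0 by rewrite -card_gt0 SJ0 card_gt0.
  have cv : (#|cover S| <= v)%N by exact: max_card.
  rewrite -{2}(subnK cv) exprD invfM mulrA mulfV ?mul1r ?expf_neq0 ?gt_eqF //.
  rewrite ler_pdivlMr // ler_pdivrMl ?exprn_gt0 // -SJ0; exact: Dle.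
rewrite sumr_const -[leLHS]mulr_natl mulrA ler_wpM2r // natrM ler_wpM2r // ler_nat.
rewrite -card_powerset; apply/subset_leq_card/subsetP => S.
by rewrite unfold_in inE => /andP[].
Qed.

Variable T : hgraph r.

Definition touches n (f : {ffun vert T -> 'I_n}) (l : {set vert T} * 'I_t) (u : slot n) :=
  [&& l.1 \in edges T, J l.2, val u.1 == f @: l.1 & u.2 == l.2].

Definition mono_free n (I : {set slot n}) := forall j, J j -> forall f, f \in embs (Q j) n ->
  ~~ (cimg f j \subset I).

(** A container of weight at most [eps] has few copies of each [Q j], so by supersaturation a
    proportion [c0] of the copies of [T] avoids it. *)
Lemma ramsey_containers : exists c0 B q0 : R, [/\ 0 < c0, c0 <= 1, 0 <= B, 0 < q0 &
  exists n0 : nat, forall n (q : R), (n0 <= n)%N -> 0 < q <= q0 -> 1 <= n%:R ^+ r * q ->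
  (forall j, J j -> rich (Q j) n q (n%:R ^+ r * q)) ->
  exists cont : {set slot n} -> {set slot n}, forall I, mono_free I ->
  exists S : {set slot n}, [/\ S \subset I, #|S|%:R <= B * (n%:R ^+ r * q), I \subset cont S &
    avoidable c0 (embs T n) (@touches n) (cont S)]].
Proof.
have [c0 [eps [c00 c01 eps0 [n0 super]]]] := ramsey_supersaturation R Q J T.
have K1 : 1 <= spread_const.
  by rewrite /spread_const addrAC lerDr addr_ge0 // sumr_ge0.
have [B [q0 [B0 q00 contain]]] := containers (\sum_j #|edges (Q j)|) K1 eps0.
exists c0, B, q0; split=> //; exists n0.+1 => n q n0n /andP[qp qq0] D1 Dle.
set D := n%:R ^+ r * q in D1 Dle *.
have n_gt0 : (0 < n)%N by rewrite (leq_trans _ n0n).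
have D0 : 0 < D by apply: lt_le_trans D1.
have VD : #|{: slot n}|%:R * q <= spread_const * D.
  rewrite /D mulrA ler_wpM2r ?(ltW qp) //.
  apply: (@le_trans _ _ (t%:R * n%:R ^+ r)).
    by rewrite -natrX -natrM ler_nat card_slot.
  rewrite ler_wpM2r ?exprn_ge0 // /spread_const -addrA lerDl addr_ge0 // sumr_ge0 //.
have := contain _ (@copy_weight n) q D; rewrite qp qq0 => /(_ isT D1 VD (@copy_weight_ge0 n)).
have spr := copy_weight_spread n_gt0 qp D0 Dle.
have small E : 0 < @copy_weight n E -> (#|E| <= \sum_j #|edges (Q j)|)%N.
  move=> /copy_weight_gt0[j [Jj [f fQ ->]]].
  by rewrite card_cimg // (bigD1 j) //= leq_addr.
move=> /(_ small spr)/covered_container/(_ set0)[cont contP]; exists cont => I I_free.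
have [|//|S [SI SB IS wS]] := contP I; rewrite ?sub0set //.
  move=> E /copy_weight_gt0[j [Jj [f fQ ->]]]; exact: I_free.
exists S; split=> //; first by move: SI; rewrite setD0.
have few j : J j -> #|[set f in embs (Q j) n | [forall x in eimg f, (x, j) \in cont S]]|%:R <=
    eps * n%:R ^+ #|vert (Q j)|.
  move=> Jj; rewrite -ler_pdivrMr ?exprn_gt0 ?ltr0n //; apply: le_trans wS.
  rewrite sum_copy_weight (bigD1 j) //= -[leLHS]addr0 lerD //; last first.
    by do 2![apply: sumr_ge0 => ? _]; case: ifP => // _; rewrite invr_ge0 exprn_ge0.
  rewrite mulr_natl -sumr_const big_mkcond [leRHS]big_mkcond; apply: ler_sum => f _.
  rewrite inE; case: (f \in embs _ _) => //=.
  case: forall_inP => [fS|_]; last by case: ifP => // _; rewrite invr_ge0 exprn_ge0.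
  rewrite ifT //; apply/subsetP => _ /imsetP[x xf ->]; exact: fS.
have := super n (ltnW n0n) (cont S) few; set X := [set f in _ | _] => many.
rewrite /avoidable; set H := hitting _ _ _.
have dis : [disjoint H & X].
  rewrite -setI_eq0; apply/eqP/setP => f; rewrite !inE; apply/negP => /andP[/andP[fT /existsP[u]]].
  move=> /andP[uC /existsP[l /and4P[lT Jl ul /eqP ul2]]] /andP[_ /forall_inP/(_ u.1)].
  have uf : u.1 \in eimg f by apply/eimgP; exists l.1; rewrite // (eqP ul).
  by move=> /(_ uf)/forall_inP/(_ l.2 Jl)/negP[]; rewrite -ul2 -surjective_pairing.
have HX : (#|H| + #|X| <= #|embs T n|)%N.
  have -> : (#|H| + #|X| = #|H :|: X|)%N by rewrite cardsU (disjoint_setI0 dis) cards0 subn0.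
  apply/subset_leq_card/subsetP => f; rewrite !inE.
  by case/orP => /andP[].
have embs_n : #|embs T n|%:R <= n%:R ^+ #|vert T| :> R.
  have := card_ffun (vert T) 'I_n; rewrite card_ord => nT.
  by rewrite -natrX ler_nat -nT max_card.
move: HX; rewrite -(ler_nat R) natrD mulrBl mul1r => HX.
have := ler_wpM2l (ltW c00) embs_n; lra.
Qed.

End ColouredCopies.

Lemma exists_expr_ge (R : archiRealFieldType) (y X : R) : 0 < y -> exists k, X <= (1 + y) ^+ k.
Proof.
move=> y0; have bern k : 1 + k%:R * y <= (1 + y) ^+ k.
  elim: k => [|k IHk]; first by rewrite mul0r addr0 expr0.
  have y1 : 0 <= 1 + y by lra.
  rewrite exprSr; apply: le_trans (ler_wpM2r y1 IHk); rewrite -natr1.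
  have : 0 <= k%:R * y * y by rewrite !mulr_ge0 // ltW.
  lra.
exists (Num.bound (`|X| / y)); apply: le_trans (bern _).
have := archi_boundP (divr_ge0 (normr_ge0 X) (ltW y0)).
rewrite ltr_pdivrMr // => XB; have := ler_norm X; lra.
Qed.

Lemma exists_expr_le (R : archiRealFieldType) (rho X : R) : 0 <= rho < 1 -> 0 < X ->
  exists k, rho ^+ k <= X.
Proof.
case/andP => rho0 rho1 X0; have [rho_eq0|rho_neq0] := eqVneq rho 0.
  by exists 1%N; rewrite rho_eq0 expr1 ltW.
have rho_gt0 : 0 < rho by rewrite lt_def rho_neq0.
have y0 : 0 < rho^-1 - 1 by rewrite subr_gt0 invf_gt1.
have [k] := exists_expr_ge X^-1 y0.
rewrite addrC subrK exprVn lef_pV2 ?posrE ?exprn_gt0 // => kX.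
by exists k.
Qed.

(** * The probability of a bad colouring *)

Section BadColourings.
Variables (r t : nat) (Q : 'I_t -> hgraph r) (J : pred 'I_t) (T : hgraph r) (i0 : 'I_t).
Local Notation slot n := (rsubset r n * 'I_t)%type.

(** Only [i0] and the colours of [J] occur: these are the colours that merging identifies with
    [i0]. *)
Definition bad_set n (A : {set rsubset r n}) : bool :=
  [exists chi : {ffun rsubset r n -> 'I_t},
    [&& [forall x in A, (chi x == i0) || J (chi x)],
        [forall f in embs T n, ~~ (eimg f \subset [set x in A | chi x == i0])] &
        [forall j, J j ==> [forall f in embs (Q j) n, ~~ (eimg f \subset [set x in A | chi x == j])]]]].

(** No copy of [T] is entirely of colour [i0], so each copy in the tuple has an edge with a colour
    in [J]; the chosen edges inherit the absence of [Q j] in colour [j]. *)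
Lemma bad_tuples_covered n M (t0 : {ffun 'I_M -> {ffun vert T -> 'I_n}}) :
  t0 \in bad_tuples (embs T n) (@eimg r T n) M (@bad_set n) ->
  exists (v : 'I_M -> slot n) (l : 'I_M -> {set vert T} * 'I_t),
    (forall i u, touches J (t0 i) (l i) u = (u == v i)) /\
    mono_free Q J [set v i | i : 'I_M].
Proof.
rewrite inE => /andP[/forallP t0T /existsP[A /andP[/existsP[chi]]]].
case/and3P=> /forall_inP chiA /forall_inP noT /forallP noQ /forallP t0A.
have pick_slot i : exists y : {set vert T} * slot n,
    [&& y.1 \in edges T, J y.2.2, val y.2.1 == t0 i @: y.1, y.2.1 \in A & y.2.2 == chi y.2.1].
  have /subsetPn[x xi] := noT _ (t0T i).
  rewrite inE (subsetP (t0A i)) //= => xi0; have /eimgP[e eT xe] := xi.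
  have xA := subsetP (t0A i) x xi.
  exists (e, (x, chi x)); rewrite /= eT xA eqxx xe eqxx !andbT.
  by have := chiA x xA; rewrite (negbTE xi0).
have [y yP] := choice pick_slot.
exists (fun i => (y i).2), (fun i => ((y i).1, (y i).2.2)); split.
  move=> i u; have /and5P[y1 y2 /eqP y3 _ _] := yP i.
  by rewrite /touches /= y1 y2 -y3 /= -pair_eqE.
move=> j Jj f fQ; apply/negP => /subsetP fI.
have := noQ j; rewrite Jj => /forall_inP/(_ f fQ)/negP[].
apply/subsetP => x xf; have /imsetP[i _ xi] : (x, j) \in [set (y i).2 | i : 'I_M].
  by apply: fI; apply: imset_f.
by have /and5P[_ _ _] := yP i; rewrite -xi inE /= eq_sym => -> ->.
Qed.

Lemma bad_set_prob (R : archiRealFieldType) :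
  exists C rho q0 : R, [/\ 0 <= C, 0 <= rho < 1, 0 < q0 &
  exists n0 : nat, forall n (q p om : R), (n0 <= n)%N -> 0 < q <= q0 ->
  1 <= n%:R ^+ r * q -> 0 < p <= 1 -> 0 < om ->
  (forall j, J j -> rich (Q j) n q (n%:R ^+ r * q)) -> rich T n p (om * (n%:R ^+ r * q)) ->
  exists2 M : nat, n%:R ^+ r * q <= M%:R &
    \sum_(A | @bad_set n A) prw p A <= C / om + rho ^+ M].
Proof.
have [c0 [B [q0 [c00 c01 B0 q00 [n0 cont_ex]]]]] := ramsey_containers R Q J T.
pose L : R := #|{: {set vert T} * 'I_t}|%:R.
have L0 : 0 <= L by [].
have L1 : 0 < 4 * (L + 1) by lra.
(* With this [x] the base [1 - c0 + L * x] is at most [1 - 3 * c0 / 4]. The [k] chosen below lets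
   [(1 + c0 / 4) ^+ M] absorb [x^-1 ^+ b], because [M] is [k.+1 * b]. *)
pose x := c0 / (4 * (L + 1)).
have x01 : 0 < x <= 1.
  by rewrite divr_gt0 //= ler_pdivrMr // mul1r; lra.
have Lx : L * x <= c0 / 4.
  rewrite mulrA ler_pdivrMr //; have := mulr_ge0 L0 (ltW c00); lra.
have Lx0 : 0 <= L * x by rewrite mulr_ge0 //; lra.
have [k kx] : exists k, x^-1 <= (1 + c0 / 4) ^+ k by apply: exists_expr_ge; lra.
pose CT : R := (pair_const T)%:R.
have CT0 : 0 <= CT by exact: ler0n.
(* Then [1 - 3 * eps = 1 - c0 / 4], whose square is at least [1 - c0 / 2]; this gives
   [rho = 1 - c0 / 4]. *)
pose eps := c0 / 12.
have eps0 : 0 < eps by rewrite /eps; lra.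
exists (CT * (1 + k.+1%:R * (B + 2)) / eps ^+ 2), (1 - c0 / 4), q0; split=> //.
- apply: divr_ge0; last by rewrite exprn_ge0 // ltW.
  by apply: mulr_ge0 => //; apply: addr_ge0 => //; apply: mulr_ge0 => //; apply: addr_ge0.
- by apply/andP; split; lra.
exists (maxn n0 #|vert T|) => n q p om; rewrite geq_max => /andP[n0n vn] qq0 D1 p01 om0 HQ HT.
have [cont contP] := cont_ex n q n0n qq0 D1 HQ.
set D := n%:R ^+ r * q in D1 HQ HT contP *.
have D0 : 0 < D by apply: lt_le_trans D1.
have p0 : 0 < p by case/andP: p01.
have BD0 : 0 <= (B + 1) * D by rewrite mulr_ge0 ?addr_ge0 // ltW.
(* [b] exceeds [B * D], the fingerprint size, and also [D], so that [D <= M]; it stays below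
   [(B + 2) * D] because [1 <= D]. *)
pose b := (Num.truncn ((B + 1) * D)).+1.
have /andP[bD bD'] := truncn_itv BD0; rewrite -/b in bD'.
have b_le : b%:R <= (B + 2) * D.
  have -> : b%:R = (Num.truncn ((B + 1) * D))%:R + 1 :> R by rewrite natr1.
  move: bD; lra.
pose M := (k.+1 * b)%N.
have M_gt0 : (0 < M)%N by rewrite muln_gt0.
exists M.
  rewrite /M natrM mulrDl mul1r in bD' *.
  have : 0 <= B * D by rewrite mulr_ge0 // ltW.
  have : b%:R <= k.+1%:R * b%:R :> R by rewrite ler_peMl // ler1n.
  lra.
have few_bad : #|bad_tuples (embs T n) (@eimg r T n) M (@bad_set n)|%:R <=
    ((1 - c0 / 2) * #|embs T n|%:R) ^+ M :> R.
  have := @card_covered_tuples R _ _ _ M b c0 x (embs T n) (@touches r t J T n) cont c01 x01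
    (bad_tuples (embs T n) (@eimg r T n) M (@bad_set n)).
  move=> H; apply: le_trans (H _ _) _ => {H} [t0|t0 t0bad|].
  - by rewrite inE => /andP[/forallP].
  - have [v [l [vl free]]] := bad_tuples_covered t0bad.
    have [S [SI SB IS avS]] := contP _ free.
    exists v, l; split=> //; exists S; split=> //.
    rewrite -(ler_nat R) (le_trans SB) // (le_trans _ (ltW bD')) //.
    by rewrite mulrDl lerDl mul1r ltW.
  rewrite exprMn ler_wpM2r ?exprn_ge0 // -/L.
  have c4 : 0 <= 1 + c0 / 4 by lra.
  (* The product of the two bases is at most [1 - c0 / 2]. *)
  apply: (@le_trans _ _ ((1 + c0 / 4) ^+ M * (1 - 3 * c0 / 4) ^+ M)).
    rewrite ler_pM ?exprn_ge0 ?invr_ge0 //; try lra.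
      rewrite /M exprM ler_pXn2r ?nnegrE ?exprn_ge0 ?invr_ge0 //; try lra.
      rewrite (le_trans kx) // ler_weXn2l //; lra.
    by rewrite ler_pXn2r ?nnegrE //; lra.
  rewrite -exprMn ler_pXn2r ?nnegrE ?mulr_ge0 //; try lra.
  have := mulr_ge0 (ltW c00) (ltW c00); lra.
have Z0 : 0 < om * D by rewrite mulr_gt0.
have mean_gt0 : 0 < mean_copies p (embs T n) #|edges T|.
  by rewrite mulr_gt0 ?exprn_gt0 // ltr0n card_embs ffact_gt0.
have eps3 : 3 * eps < 1 by rewrite /eps; lra.
have := bad_prob p01 (@card_eimg r T n) mean_gt0 eps0 (mean_meeting_embs p01 Z0 vn HT)
  M_gt0 eps3 few_bad.
rewrite -/CT => /le_trans; apply.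
have c4 : 0 < 1 - c0 / 4 by lra.
apply: lerD.
  have MD : (1 + M%:R) / D <= 1 + k.+1%:R * (B + 2).
    by rewrite ler_pdivrMr // mulrDl mul1r lerD // /M natrM -mulrA ler_wpM2l.
  move: MD; move: (1 + M%:R) (1 + k.+1%:R * (B + 2)) => m m' mm'.
  have -> : CT / (om * D) * m / eps ^+ 2 = CT / om / eps ^+ 2 * (m / D).
    by field; rewrite !gt_eqF.
  have -> : CT * m' / eps ^+ 2 / om = CT / om / eps ^+ 2 * m'.
    by field; rewrite !gt_eqF.
  rewrite ler_wpM2l //; apply: divr_ge0; last by rewrite exprn_ge0 // ltW.
  by apply: divr_ge0 => //; exact: ltW.
rewrite ler_pXn2r ?nnegrE ?divr_ge0 //; try (rewrite /eps; lra).
have -> : 3 * eps = c0 / 4 by rewrite /eps; field.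
rewrite ler_pdivrMr //; have := mulr_ge0 (ltW c00) (ltW c00); lra.
Qed.

End BadColourings.

(** Having no copy is a deviation by more than half of the mean, which Chebyshev's inequality
    controls. *)
Lemma no_copy_prob (R : realFieldType) (r : nat) (F : hgraph r) n (p om : R) :
  0 < p <= 1 -> 0 < om -> (#|vert F| <= n)%N ->
  rich F n p om ->
  \sum_(A : {set rsubset r n} | [forall f in embs F n, ~~ (eimg f \subset A)]) prw p A <=
    4 * (pair_const F)%:R / om.
Proof.
move=> p01 om0 vn HF; set CF : R := (pair_const F)%:R.
have p0 : 0 < p by case/andP: p01.
have mean_gt0 : 0 < mean_copies p (embs F n) #|edges F|.
  by rewrite mulr_gt0 ?exprn_gt0 // ltr0n card_embs ffact_gt0.
have half0 : 0 < 1 / 2 :> R by lra.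
have := few_copies_prob p01 (@card_eimg r F n) mean_gt0 half0 (mean_meeting_embs p01 om0 vn HF).
rewrite -/CF (_ : CF / om / (1 / 2) ^+ 2 = 4 * CF / om); last by field; rewrite gt_eqF.
apply: le_trans; rewrite big_mkcond [leRHS]big_mkcond; apply: ler_sum => A _.
have pA := prw_ge0 p01 A; case: ifP => [/forall_inP none|_]; last by case: ifP.
rewrite ifT // (_ : copies_in _ _ _ = set0) ?cards0; first by lra.
by apply/setP => f; rewrite in_set in_set0; apply/negP => /andP[/none/negbTE ->].
Qed.

(** * Transfer from H to the r-graphs that are Ramsey for H *)

Section ComposedCopies.
Variables (r n : nat) (A : {set rsubset r n}) (G : hgraph r) (phi : 'I_n -> vert G).
Hypothesis phi_inj : injective phi.
Hypothesis phiA : forall x, x \in A -> phi @: val x \in edges G.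

Lemma embedding_copy (F : hgraph r) (f : {ffun vert F -> 'I_n}) : f \in embs F n ->
  eimg f \subset A ->
  copy F ((phi \o f) @: [set: vert F], [set phi @: val x | x : rsubset r n in eimg f]).
Proof.
move=> fF /subsetP fA; split.
  rewrite inE /=; apply/andP; split.
    by apply/subsetP => _ /imsetP[x /fA/phiA ? ->].
  apply/forall_inP => _ /imsetP[x /eimgP[e eF ->] ->].
  by apply/subsetP => _ /imsetP[_ /imsetP[u _ ->] ->]; apply/imsetP; exists u.
exists (phi \o f); split=> //; first by move=> u v /phi_inj/(embsP fF).
apply/setP => y; apply/imsetP/imsetP => [[e eF ->]|[x /eimgP[e eF xe] ->]].
  have [x xe xf] := edge_rsubset fF eF; exists x => //.
  by rewrite xe imset_comp.
by exists e => //; rewrite xe -imset_comp.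
Qed.

End ComposedCopies.

(** Merging yields a copy of H of a single colour [i]. If [i] is not [i0], it contains [Q i] in
    colour [i]. If it is [i0], the original colours on this copy are [i0] and those from [s] on, and
    goodness of [A] provides the required copy. *)
Lemma ramsey_merge (r s t n : nat) (Q : 'I_t -> hgraph r) (i0 : 'I_t) (A : {set rsubset r n}) :
  (i0 < s)%N -> (s <= t)%N ->
  ~~ bad_set Q (fun j => s <= j)%N (Q i0) i0 A ->
  (forall j : 'I_t, (j < s)%N -> j != i0 -> [exists f in embs (Q j) n, eimg f \subset A]) ->
  subfamily (ramsey (fun _ : 'I_s => hgraph_of A)) (ramsey Q).
Proof.
move=> i0s st good Qcopy G GH c.
pose merge (j : 'I_t) : 'I_s := if insub (j : nat) is Some i then i else Ordinal i0s.
have mergeE (j : 'I_t) : merge j = (if (j < s)%N then j else i0) :> nat.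
  by rewrite /merge; case: insubP => [i -> ->|/negbTE ->].
have [i [J [[JG [phi [phi_inj _ phiJ]]] Jc]]] := GH (merge \o c).
have phiA x : x \in A -> phi @: val x \in J.2.
  move=> xA; rewrite -phiJ; apply: imset_f; exact: imset_f.
have JG2 : J.2 \subset edges G by move: JG; rewrite inE => /andP[].
have phiG x : x \in A -> phi @: val x \in edges G by move/phiA/(subsetP JG2).
pose edge_of x (xA : x \in A) : {e : {set vert G} | e \in edges G} :=
  exist _ (phi @: val x) (phiG x xA).
have colour_copy (j : 'I_t) (f : {ffun vert (Q j) -> 'I_n}) : f \in embs (Q j) n -> eimg f \subset A ->
    (forall x (xA : x \in A), x \in eimg f -> c (edge_of x xA) = j) ->
    exists (j : 'I_t) (J : {set vert G} * {set {set vert G}}),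
      copy (Q j) J /\ forall e, val e \in J.2 -> c e = j.
  move=> fQ fA fc; exists j; eexists; split; first exact: embedding_copy phi_inj phiG _ _ fQ fA.
  move=> e /imsetP[x xf ex]; rewrite -(fc x (subsetP fA x xf) xf); congr c.
  exact: val_inj.
have cJ x (xA : x \in A) : merge (c (edge_of x xA)) = i by apply: Jc; exact: phiA.
have [ii0|ii0] := eqVneq (i : nat) i0.
  have chiE : exists chi : {ffun rsubset r n -> 'I_t},
      forall x (xA : x \in A), chi x = c (edge_of x xA).
    exists [ffun x : rsubset r n => if insub (phi @: val x) is Some e then c e else i0] => x xA.
    rewrite ffunE; case: insubP => [e eG ee|]; last by rewrite phiG.
    by congr c; apply: val_inj.
  case: chiE => chi chiE; move: good; rewrite negb_exists => /forallP/(_ chi).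
  rewrite !negb_and => /or3P[/forall_inPn[x xA]|/forall_inPn[f fQ]|/forallPn[j]].
  - rewrite (chiE x xA) => /negP[]; have := congr1 val (cJ x xA); rewrite /= mergeE.
    case: ltnP => [_ ci|_ _]; last by rewrite orbT.
    by apply/orP; left; apply/eqP/val_inj; exact: etrans ci ii0.
  - rewrite negbK => /subsetP fc; apply: (colour_copy i0 f fQ).
      by apply/subsetP => x /fc; rewrite inE => /andP[].
    by move=> x xA /fc; rewrite inE (chiE x xA) => /andP[_ /eqP].
  rewrite negb_imply => /andP[_ /forall_inPn[f fQ]]; rewrite negbK => /subsetP fc.
  apply: (colour_copy j f fQ).
    by apply/subsetP => x /fc; rewrite inE => /andP[].
  by move=> x xA /fc; rewrite inE (chiE x xA) => /andP[_ /eqP].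
pose j := widen_ord st i.
have /existsP[f /andP[fQ fA]] : [exists f in embs (Q j) n, eimg f \subset A].
  by apply: Qcopy; [exact: ltn_ord i | rewrite -val_eqE].
apply: (colour_copy j f fQ fA) => x xA _; apply: val_inj => /=.
have := congr1 val (cJ x xA); rewrite /= mergeE; case: ltnP => // _ i0i.
by rewrite i0i eqxx in ii0.
Qed.

(** * Densities and thresholds *)

Section DensityExponents.
Variables (R : realType) (r : nat).
Implicit Types F T : hgraph r.

Lemma cover_subhgraphs F (S : {set {set vert F}}) : S \subset edges F ->
  (cover S, S) \in subhgraphs F.
Proof.
move=> SF; rewrite inE SF /=; apply/forall_inP => e eS.
by apply/subsetP => v ve; apply/bigcupP; exists e.
Qed.

Lemma card_cover_ge F (S : {set {set vert F}}) : S \subset edges F -> S != set0 ->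
  (r <= #|cover S|)%N /\ ((1 < #|S|)%N -> (r < #|cover S|)%N).
Proof.
move=> SF /set0Pn[e eS]; have sub_cover (d : {set vert F}) : d \in S -> d \subset cover S.
  by move=> dS; apply/subsetP => v vd; apply/bigcupP; exists d.
have cardS d : d \in S -> #|d| = r by move/(subsetP SF)/edges_uniform.
split; first by have := subset_leq_card (sub_cover e eS); rewrite cardS.
move=> S1; have [d dS de] : exists2 d, d \in S & d != e.
  move: S1; rewrite (cardsD1 e) eS ltnS card_gt0 => /set0Pn[d]; rewrite !inE => /andP[de dS].
  by exists d.
suff /proper_card : e \proper cover S by rewrite (cardS e eS).
rewrite properE sub_cover //=; apply: contra de => cov; rewrite eqEcard (cardS e eS) (cardS d dS) leqnn andbT.
exact: subset_trans (sub_cover d dS) cov.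
Qed.

(** For at least two edges this is the definition applied to [(cover S, S)]; for one edge the left
    side is 0. *)
Lemma max_rdensity_cover F (S : {set {set vert F}}) (d : R) : 0 < d -> max_rdensity R F <= d ->
  S \subset edges F -> S != set0 -> #|S|%:R - 1 <= d * (#|cover S|%:R - r%:R).
Proof.
move=> d0 Fd SF S0; have [rc rc'] := card_cover_ge SF S0.
have [S1|S1] := leqP #|S| 1.
  apply: (@le_trans _ _ 0); first by rewrite subr_le0 lern1.
  by rewrite mulr_ge0 ?(ltW d0) // subr_ge0 ler_nat.
have cr : 0 < #|cover S|%:R - r%:R :> R by rewrite subr_gt0 ltr_nat rc'.
rewrite -ler_pdivrMr //; apply: le_trans Fd.
have F2 := leq_trans S1 (subset_leq_card SF).
rewrite /max_rdensity; case: eqP => [F0|_]; first by rewrite F0 in F2.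
case: eqP => [F1|_]; first by rewrite F1 in F2.
apply: (@le_bigmax_cond _ _ _ _ (cover S, S) _
  (fun J : {set vert F} * {set {set vert F}} => (#|J.2|%:R - 1) / (#|J.1|%:R - r%:R))).
by rewrite cover_subhgraphs //= rc'.
Qed.

Lemma asym_rdensity_cover T F (S : {set {set vert T}}) (d : R) : 0 < max_rdensity R F ->
  asym_rdensity R T F <= d -> S \subset edges T -> S != set0 ->
  #|S|%:R <= d * (#|cover S|%:R - r%:R + (max_rdensity R F)^-1).
Proof.
move=> F0 Td ST S0; have [rc _] := card_cover_ge ST S0.
have cr : 0 < #|cover S|%:R - r%:R + (max_rdensity R F)^-1.
  by rewrite ltr_wpDl ?invr_gt0 // subr_ge0 ler_nat.
rewrite -ler_pdivrMr //; apply: le_trans Td.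
apply: (@le_bigmax_cond _ _ _ _ (cover S, S) _ (fun J : {set vert T} * {set {set vert T}} =>
  #|J.2|%:R / (#|J.1|%:R - r%:R + (max_rdensity R F)^-1))).
by rewrite cover_subhgraphs.
Qed.

Lemma max_density_cover F (S : {set {set vert F}}) (d : R) : (0 < r)%N ->
  max_density R F <= d -> S \subset edges F -> S != set0 -> #|S|%:R <= d * #|cover S|%:R.
Proof.
move=> r0 Fd SF S0; have [rc _] := card_cover_ge SF S0.
have c0 := leq_trans r0 rc.
rewrite -ler_pdivrMr ?ltr0n //; apply: le_trans Fd.
apply: (@le_bigmax_cond _ _ _ _ (cover S, S) _
  (fun J : {set vert F} * {set {set vert F}} => #|J.2|%:R / #|J.1|%:R)).
by rewrite cover_subhgraphs.
Qed.

Lemma max_density_gt0 F : (0 < r)%N -> 0 < max_rdensity R F -> 0 < max_density R F.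
Proof.
move=> r0 F0; have /set0Pn[e eF] : edges F != set0.
  by apply: contraTneq F0 => F0; rewrite /max_rdensity F0 cards0 eqxx ltxx.
have SF : [set e] \subset edges F by rewrite sub1set.
have S0 : [set e] != set0 by apply/set0Pn; exists e; rewrite set11.
have [rc _] := card_cover_ge SF S0.
have := max_density_cover r0 (lexx _) SF S0; rewrite cards1 => le1.
have := lt_le_trans ltr01 le1.
by rewrite pmulr_lgt0 // ltr0n (leq_trans r0).
Qed.

(** Reduces richness to comparing exponents of [n]; of the factor [om ^+ #|S|] only one [om] is
    kept. *)
Lemma rich_powR F n (om a b : R) : (0 < n)%N -> 1 <= om ->
  (forall S : {set {set vert F}}, S \subset edges F -> S != set0 ->
     b <= #|cover S|%:R - a * #|S|%:R) ->
  rich F n (om * n%:R `^ (- a)) (om * n%:R `^ b).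
Proof.
move=> n0 om1 Sb S SF S0; have nR : 0 < n%:R :> R by rewrite ltr0n.
have om0 : 0 < om by apply: lt_le_trans om1.
have -> : n%:R ^+ #|cover S| * (om * n%:R `^ (- a)) ^+ #|S| =
    om ^+ #|S| * n%:R `^ (#|cover S|%:R - a * #|S|%:R).
  rewrite exprMn mulrCA -!powR_mulrn ?powR_ge0 ?ler0n ?(ltW om0) //.
  by rewrite -powRrM -powRD ?mulNr // (gt_eqF nR) implybT.
apply: ler_pM; rewrite ?powR_ge0 ?(ltW om0) //; last first.
  by apply: ler_powR; [rewrite ler1n | exact: Sb].
by rewrite -[leLHS]expr1 ler_weXn2l // card_gt0.
Qed.

Lemma powR_nat_large (b X : R) : 0 < b ->
  exists n0 : nat, forall n, (n0 <= n)%N -> X <= n%:R `^ b.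
Proof.
move=> b0; pose Y := Num.max X 1.
have Y0 : 0 <= Y by rewrite le_max ler01 orbT.
exists (Num.bound (Y `^ b^-1)) => n n0n.
apply: (@le_trans _ _ Y); first by rewrite le_max lexx.
have -> : Y = (Y `^ b^-1) `^ b by rewrite -powRrM mulVf ?powRr1 // gt_eqF.
apply: ge0_ler_powR; rewrite ?nnegrE ?(ltW b0) ?powR_ge0 ?ler0n //.
apply: le_trans (ltW (archi_boundP (powR_ge0 _ _))) _.
by rewrite ler_nat.
Qed.

End DensityExponents.

(** * Assembling the estimates *)

Lemma hprob_ge (R : realType) (r t n : nat) (p : R) (P : hfamily r)
    (B : pred {set rsubset r n}) (C : 'I_t -> pred {set rsubset r n}) : 0 < p <= 1 ->
  (forall A, ~~ B A -> (forall j, ~~ C j A) -> P (hgraph_of A)) ->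
  1 - \sum_(A | B A) prw p A - \sum_j \sum_(A | C j A) prw p A <= hprob n p P <= 1.
Proof.
move=> p01 BCP; have total := @sum_prw R (rsubset r n) p.
have prw0 (A : {set rsubset r n}) := prw_ge0 p01 A.
apply/andP; split; last first.
  rewrite -[leRHS]total /hprob big_mkcond; apply: ler_sum => A _.
  by case: ifP => // _; exact: prw0.
rewrite !lerBlDr -total.
rewrite [X in _ <= X + _ + _]big_mkcond [X in _ <= _ + X + _](exchange_big_dep predT) //=.
rewrite [X in _ <= _ + X]big_mkcond -!big_split /=.
apply: ler_sum => A _; have pA := prw0 A.
have sum0 (b : pred 'I_t) : 0 <= \sum_(j | b j) prw p A by apply: sumr_ge0.
have [PA|nPA] := asboolP (P (hgraph_of A)).
  by rewrite -addrA lerDl addr_ge0 ?sum0 //; case: ifP.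
have [bA|nbA] := boolP (B A); first by rewrite add0r lerDr; exact: sum0.
have [j cA] : exists j, C j A.
  by apply: contrapT => none; apply: nPA; apply: BCP => // j; apply/negP => cA; apply: none; exists j.
by rewrite add0r addr0 (bigD1 j) //= lerDl; exact: sum0.
Qed.

Lemma ramsey_family_prob (R : realType) (r s t : nat) (Q : 'I_t -> hgraph r) (i0 i1 : 'I_t)
    (delta e : R) : (0 < r)%N -> (i0 < s)%N -> (s <= t)%N ->
  (forall j : 'I_t, (s <= j)%N -> max_rdensity R (Q j) <= max_rdensity R (Q i1)) ->
  1 < max_rdensity R (Q i1) -> asym_rdensity R (Q i0) (Q i1) <= delta ->
  (forall j, max_density R (Q j) <= delta) -> 0 < delta -> 0 < e ->
  exists (n0 : nat) (om0 : R), forall n p, (n0 <= n)%N -> 0 < p <= 1 ->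
    om0 <= p / n%:R `^ (- (1 / delta)) ->
    1 - e <= hprob n p (fun H => subfamily (ramsey (fun _ : 'I_s => H)) (ramsey Q)) <= 1.
Proof.
move=> r0 i0s st dec d1 asym dens delta0 e0.
set d := max_rdensity R (Q i1) in dec d1.
have d0 : 0 < d by apply: lt_trans d1.
pose a := d^-1.
have a0 : 0 < a by rewrite invr_gt0.
have a1 : a < 1 by rewrite invf_lt1.
have ra : 0 < r%:R - a by rewrite subr_gt0 (lt_le_trans a1) // ler1n.
have [C [rho [q0 [C0 rho01 q00 [n1 badP]]]]] :=
  bad_set_prob Q (fun j => s <= j)%N (Q i0) i0 R.
(* Three failures share [e]: the two error terms of [bad_set_prob], and a missing copy of some
   [Q j]. *)
have e3 : 0 < e / 3 by lra.
have [k rho_k] := exists_expr_le rho01 e3.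
have [n2 q_small] := powR_nat_large q0^-1 a0.
have [n3 D_large] := powR_nat_large (1 + k%:R) ra.
pose S : R := \sum_(j < t) 4 * (pair_const (Q j))%:R.
have S0 : 0 <= S by apply: sumr_ge0 => j _; rewrite mulr_ge0.
exists (maxn (maxn n1 n2) (maxn n3 (1 + \sum_(j < t) #|vert (Q j)|)%N)), (1 + 3 * C / e + 3 * S / e).
move=> n p; rewrite !geq_max => /andP[/andP[n1n n2n] /andP[n3n vn']] p01.
have n_gt0 : (0 < n)%N by apply: leq_trans vn'.
have vn := ltnW vn'.
set om := p / _ => om_large.
have vQ j : (#|vert (Q j)| <= n)%N.
  by apply: leq_trans vn; rewrite (bigD1 j) //= leq_addr.
have nR : 0 < n%:R :> R by rewrite ltr0n.
have Ce : 0 <= 3 * C / e by rewrite divr_ge0 ?mulr_ge0 // ltW.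
have Se : 0 <= 3 * S / e by rewrite divr_ge0 ?mulr_ge0 // ltW.
have om1 : 1 <= om by lra.
have om0 : 0 < om by lra.
have pE : p = om * n%:R `^ (- (1 / delta)) by rewrite mulfVK // gt_eqF // powR_gt0.
pose q := n%:R `^ (- a) : R.
have q01 : 0 < q <= q0.
  by rewrite powR_gt0 //= /q powRN -[q0]invrK lef_pV2 ?posrE ?invr_gt0 ?powR_gt0 // q_small.
have DE : n%:R ^+ r * q = n%:R `^ (r%:R - a) :> R.
  by rewrite -powR_mulrn // -powRD // (gt_eqF nR) implybT.
have D_ge := D_large n n3n; rewrite -DE in D_ge.
have D1 : 1 <= n%:R ^+ r * q by apply: le_trans D_ge; rewrite lerDl.
(* By the bound on the r-density, [#|U| - 1 <= d * (#|cover U| - r)]; multiplying by [a = 1 / d]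
   gives the exponent inequality [r - a <= #|cover U| - a * #|U|]. *)
have richQ (j : 'I_t) : (s <= j)%N -> rich (Q j) n q (n%:R ^+ r * q).
  move=> sj; rewrite DE -[q]mul1r -[n%:R `^ (r%:R - a)]mul1r; apply: rich_powR => // U UQ U0.
  have := max_rdensity_cover d0 (dec j sj) UQ U0.
  have -> : d = a^-1 by rewrite invrK.
  by rewrite mulrC ler_pdivlMr // mulrBl mul1r [_ * a]mulrC; lra.
(* The asymmetric density gives [#|U| / delta <= #|cover U| - r + a], the same lower bound [r - a]
   with exponent [1 / delta] for [p]. *)
have richT : rich (Q i0) n p (om * (n%:R ^+ r * q)).
  rewrite pE DE; apply: rich_powR => // U UT U0.
  have := asym_rdensity_cover d0 asym UT U0; rewrite -/d -/a => dU.
  have : #|U|%:R / delta <= #|cover U|%:R - r%:R + a by rewrite ler_pdivrMr // mulrC.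
  lra.
have richM j : rich (Q j) n p om.
  have main := @rich_powR R r (Q j) n om (1 / delta) 0 n_gt0 om1.
  rewrite powRr0 mulr1 -pE in main; apply: main => U UQ U0.
  have := max_density_cover r0 (dens j) UQ U0 => dU.
  have : #|U|%:R / delta <= #|cover U|%:R by rewrite ler_pdivrMr // mulrC.
  lra.
have [M DM bad_le] := badP n q p om n1n q01 D1 p01 om0 richQ richT.
have kM : (k <= M)%N by rewrite -(ler_nat R) (le_trans _ DM) // (le_trans _ D_ge) // lerDr.
have rhoM : rho ^+ M <= e / 3.
  case/andP: rho01 => rho0 rho1; apply: le_trans rho_k.
  by apply: ler_wiXn2l => //; exact: ltW.
have Com : C / om <= e / 3.
  rewrite ler_pdivrMr // mulrC -ler_pdivrMr // (le_trans _ om_large) //.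
  have -> : C / (e / 3) = 3 * C / e by field; rewrite gt_eqF.
  lra.
have Som : S / om <= e / 3.
  rewrite ler_pdivrMr // mulrC -ler_pdivrMr // (le_trans _ om_large) //.
  have -> : S / (e / 3) = 3 * S / e by field; rewrite gt_eqF.
  lra.
pose none j (A : {set rsubset r n}) := [forall f in embs (Q j) n, ~~ (eimg f \subset A)].
have none_le : \sum_j \sum_(A | none j A) prw p A <= S / om.
  by rewrite mulr_suml; apply: ler_sum => j _; exact: no_copy_prob.
have := hprob_ge (B := @bad_set _ _ Q (fun j => s <= j)%N (Q i0) i0 n) (C := none) p01
  (P := fun H => subfamily (ramsey (fun _ : 'I_s => H)) (ramsey Q)).
case/(_ _)/Wrap => [A good has_copy|/andP[ge le]].
  apply: (ramsey_merge i0s st good) => j _ _; have := has_copy j.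
  rewrite negb_forall_in => /exists_inP[f fQ]; rewrite negbK => fA.
  by apply/exists_inP; exists f.
rewrite le andbT; apply: le_trans ge; lra.
Qed.

From mathcomp Require Import all_classical all_reals all_analysis.

Import numFieldNormedType.Exports.

Local Open Scope classical_set_scope.
Local Open Scope ring_scope.

(* 'I_t is 0-based: Q_1 is Q at 0 and Q_(s+1) is Q at s. *)
Theorem proposition2 (R : realType) (r s t : nat)
    (r_ge2 : (2 <= r)%N) (s_ge2 : (2 <= s)%N) (t_ge2 : (2 <= t)%N)
    (lt_st : (s < t)%N) (Q : 'I_t -> hgraph r) (p : nat -> R) :
  let Q_1 := Q (Ordinal (ltn_trans (ltnW s_ge2) lt_st)) in
  let Q_s1 := Q (Ordinal lt_st) in
  let mu : R := \big[Num.max/0]_(i < t) max_density R (Q i) in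
  let sigma : R := \big[Num.min/asym_rdensity R Q_1 Q_s1]_(i < t | (i < s)%N)
                     asym_rdensity R (Q i) Q_s1 in
  let delta := Num.max mu sigma in
  (forall i j : 'I_t, (i <= j)%N -> max_rdensity R (Q j) <= max_rdensity R (Q i)) ->
  (forall i : 'I_t, 0 < max_rdensity R (Q i)) ->
  1 < max_rdensity R Q_s1 ->
  (forall n, 0 <= p n <= 1) ->
  dominates p (fun n => n%:R `^ (- (1 / delta))) ->
  hprob n (p n) (fun H => subfamily (ramsey (fun _ : 'I_s => H)) (ramsey Q))
    @[n --> \oo] --> (1 : R).
Proof.
move=> Q_1 Q_s1 mu sigma delta dec pos dense p01 dom.
have r_gt0 : (0 < r)%N := ltnW r_ge2.
have [i0 i0s sigmaE] : exists2 i0 : 'I_t, (i0 < s)%N & asym_rdensity R (Q i0) Q_s1 = sigma.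
  rewrite /sigma; elim/big_ind: _ => [|x y [i i_s <-] [j j_s <-]|i i_s].
  (* The default value of the minimum is the density at index 0, which is itself below [s]. *)
  - by exists (Ordinal (ltn_trans (ltnW s_ge2) lt_st)) => //=; exact: ltnW.
  - by rewrite minEle; case: ifP => _; [exists i | exists j].
  - by exists i.
have dens j : max_density R (Q j) <= delta by rewrite le_max /mu le_bigmax.
have asym : asym_rdensity R (Q i0) Q_s1 <= delta by rewrite sigmaE le_max lexx orbT.
have delta_gt0 : 0 < delta by apply: lt_le_trans (dens i0); exact: max_density_gt0.
apply/cvgrPdist_le => e e0.
have [n0 [om0 main]] := ramsey_family_prob r_gt0 i0s (ltnW lt_st)
  (fun j sj => dec (Ordinal lt_st) j sj) dense asym dens delta_gt0 e0.
(* The maximum with 1 makes the quotient positive, which forces [0 < p n]. *)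
have /cvgryPge/(_ (Num.max om0 1))[n1 _ n1P] := dom.
exists (maxn (maxn n0 n1) 1) => // n /=; rewrite !geq_max => /andP[/andP[n0n n1n] n_gt0].
have := n1P n n1n; rewrite /= ge_max => /andP[om0n om1n].
have p_gt0 : 0 < p n.
  have : 0 < p n / n%:R `^ (- (1 / delta)) by apply: lt_le_trans om1n.
  by rewrite pmulr_lgt0 // invr_gt0 powR_gt0 // ltr0n.
have := main n (p n) n0n; rewrite p_gt0; have /andP[_ ->] := p01 n.
move=> /(_ isT om0n) /andP[ge le].
rewrite ger0_norm ?subr_ge0 //; lra.
Qed.
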